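(* Let $C\subset\mathcal S$ with $\rho_C>0$ and let $t>0$. Define $$\theta_{C,t}=\mathbb E\sum_{(j,k)\in C}\int_0^t\frac{1}{\boldsymbol\xi^{(s,(j,k))}(\Gamma_{C,t})}\,\rho_{jk}\,ds .$$ Let $\{\boldsymbol\eta_i,\ i\ge 0\}$ be independent and identically distributed random measures on $\Gamma_{C,t}$ having the distribution $$\mathbb P\left[\boldsymbol\eta_0(\Gamma_{C,t})\ge 1\right]=1,\qquad \mathbb P(\boldsymbol\eta_0\in A)=\mathbb E\sum_{(j,k)\in C}\int_0^t\frac{\mathbf 1_{[\boldsymbol\xi^{(s,(j,k))}\in A]}}{\boldsymbol\xi^{(s,(j,k))}(\Gamma_{C,t})}\cdot\frac{\rho_{jk}}{\theta_{C,t}}\,ds,\quad A\in\mathcal H_{C,t},$$ where in the event $[\boldsymbol\xi^{(s,(j,k))}\in A]$ the process $\boldsymbol\xi^{(s,(j,k))}$ is understood as restricted to $\Gamma_{C,t}$. Let $M$ be a Poisson random variable with mean $\theta_{C,t}$, independent of $\{\boldsymbol\eta_i,\ i\ge 0\}$. Then $$\boldsymbol\Xi_{C,t}\stackrel{d}{=}\sum_{i=1}^M\boldsymbol\eta_i ,$$ where $\stackrel{d}{=}$ denotes equality in distribution.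
   Context: Jackson network. There are $J$ queues. Exogenous arrivals to the queues form independent Poisson processes with rates $\nu_j$, $1\le j\le J$. Service requirements are independent exponential random variables with parameter 1; when there are $m$ customers in queue $j$, the service effort of queue $j$ is $\phi_j(m)$, where $\phi_j(0)=0$, $\phi_j(1)>0$ and $\phi_j$ is non-decreasing. On completing service at queue $i$, a customer moves to queue $j$ with probability $\lambda_{ij}$ and leaves the network with probability $\mu_i$, where $\sum_{j=1}^J\lambda_{ij}+\mu_i=1$. The network is open and irreducible: all customers can access any queue with positive probability. The total arrival rates $\alpha_j$ are the unique solution of $\alpha_j=\nu_j+\sum_{i=1}^J\alpha_i\lambda_{ij}$, $1\le j\le J$, with all $\alpha_j>0$. The queue length process $\mathbf N(t)=(N_1(t),\dots,N_J(t))$, $t\in\mathbb R$, is the Markov jump process with rates $q_{\mathbf n,\mathbf n+e_j}=\nu_j$, $q_{\mathbf n,\mathbf n-e_j+e_k}=\phi_j(n_j)\lambda_{jk}$, $q_{\mathbf n,\mathbf n-e_j}=\mu_j\phi_j(n_j)$. It is assumed to be in equilibrium on $\mathbb R$: for each $t$ the $N_j(t)$ are independent with $\mathbb P(N_j(t)=k)=\frac{\alpha_j^k/\prod_{r=1}^k\phi_j(r)}{\sum_{l\ge0}\alpha_j^l/\prod_{r=1}^l\phi_j(r)}$, the normalizing sums being finite. Flow process. State $0$ denotes the outside of the network, and $\mathcal S=\{(j,k):0\le j,k\le J\}$ is the set of links. $\boldsymbol\Xi=\{\boldsymbol\Xi^{jk}\}$ is the point process on $\mathbb R\times\mathcal S$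 with a point at $(s,(j,k))$ whenever a customer makes a transition from $j$ to $k$ at time $s$ (arrivals are transitions from $0$, departures are transitions to $0$, and $j=k\ge1$ is allowed). Its mean measure is $\boldsymbol\lambda(ds,(j,k))=\rho_{jk}\,ds$, where $\rho_{jk}=\alpha_j\lambda_{jk}$ for $j,k\ge1$, $\rho_{0k}=\nu_k$, $\rho_{j0}=\alpha_j\mu_j$, $\rho_{00}=0$. For $C\subset\mathcal S$ and $t>0$: $\Gamma_{C,t}=[0,t]\times C$, $\rho_C=\sum_{(j,k)\in C}\rho_{jk}$, and $\boldsymbol\Xi_{C,t}$ is the restriction of $\boldsymbol\Xi$ to $\Gamma_{C,t}$. $H_{C,t}$ is the set of finite nonnegative integer-valued measures on $\Gamma_{C,t}$, and $\mathcal H_{C,t}$ is the $\sigma$-algebra on it generated by the sets $\{\xi\in H_{C,t}:\xi(B)=i\}$, $i\in\{0,1,2,\dots\}$, $B$ Borel in $\Gamma_{C,t}$. Palm processes. The Palm distribution of $\boldsymbol\Xi$ at $\alpha\in\mathbb R\times\mathcal S$ is $P^\alpha(\cdot)=\mathbb E[\mathbf 1_{[\boldsymbol\Xi\in\cdot]}\boldsymbol\Xi(d\alpha)]/\boldsymbol\lambda(d\alpha)$ (Radon–Nikodym derivative, $\boldsymbol\lambda$-a.e.; the version compatible with time shifts is used). $\boldsymbol\Xi^\alpha$ denotes a process with distribution $P^\alpha$. Extra-customer process. For each $(j,k)$ with $\rho_{jk}>0$, $\boldsymbol\xi^{(0,(j,k))}$ is a point process on $\mathbb R\times\mathcal S$,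 independent of $\boldsymbol\Xi$, with $\boldsymbol\xi^{(0,(j,k))}+\boldsymbol\Xi\stackrel{d}{=}\boldsymbol\Xi^{(0,(j,k))}$; such a process exists and its law is determined by this property. Concretely it is the Dirac measure $\delta_{(0,(j,k))}$ plus the transitions of an extra individual who is at $k$ just after time $0$ (followed on $(0,\infty)$) and at $j$ just before time $0$ (followed backwards on $(-\infty,0)$), the extra individual receiving instantaneous service rate $\phi_i(m+1)-\phi_i(m)$ whenever at queue $i$ together with $m$ other customers. $\boldsymbol\xi^{(s,(j,k))}$ denotes a copy of $\boldsymbol\xi^{(0,(j,k))}\circ\theta_s$, where $\theta_s((u,(j,k)))=(u-s,(j,k))$; i.e. $\boldsymbol\xi^{(0,(j,k))}$ with every point moved by $+s$ in time. Terms with $\rho_{jk}=0$ in sums weighted by $\rho_{jk}$ are taken to be $0$. *)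

(* Defs.v *)
From HB Require Import structures.
From mathcomp Require Import all_boot all_order all_algebra.
From mathcomp Require Import all_classical all_reals all_analysis.
From mathcomp Require Import measurable_realfun.

Set Implicit Arguments.
Unset Strict Implicit.
Unset Printing Implicit Defensive.

Import Order.TTheory GRing.Theory Num.Theory.
Import numFieldNormedType.Exports.

Local Open Scope classical_set_scope.
Local Open Scope ring_scope.

(* [None] is the outside of the network (state 0), [Some j] is queue j. *)
Notation node J := (option 'I_J).

HB.instance Definition _ J := @isMeasurable.Build default_measure_display
  (node J) discrete_measurable discrete_measurable0
  discrete_measurableC discrete_measurableU.

Notation link J := (node J * node J)%type.

(* The space R x S carrying the flows. *)
Notation flow_space R J := (measurableTypeR R * link J)%type.

(* The weight of a link: exogenous entries have rates [nu], and a node j which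
   releases customers at rate [f j] sends them to k at rate [f j * lam j k] and
   out of the network at rate [f j * mu j]. *)
Definition link_weight (R : realType) (J : nat) (nu : 'I_J -> R)
    (lam : 'I_J -> 'I_J -> R) (mu : 'I_J -> R) (f : 'I_J -> R) (l : link J) : R :=
  match l with
  | (None, Some k) => nu k
  | (Some j, Some k) => f j * lam j k
  | (Some j, None) => f j * mu j
  | (None, None) => 0
  end.

Record jackson_network (R : realType) (J : nat) := JacksonNetwork {
  nu : 'I_J -> R;
  phi : 'I_J -> nat -> R;
  lam : 'I_J -> 'I_J -> R;
  mu : 'I_J -> R;
  alpha : 'I_J -> R;
  nu_ge0 : forall j, 0 <= nu j;
  phi0 : forall j, phi j 0 = 0;
  phi1_gt0 : forall j, 0 < phi j 1;
  phi_nondecreasing : forall j m n, (m <= n)%N -> phi j m <= phi j n;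
  lam_ge0 : forall i j, 0 <= lam i j;
  mu_ge0 : forall i, 0 <= mu i;
  routing_sum1 : forall i, (\sum_j lam i j) + mu i = 1;
  (* Open and irreducible: the routing graph on the nodes 0..J, outside
     included, is strongly connected. *)
  open_irreducible : forall a b : node J,
    connect (fun a b => 0 < link_weight nu lam mu (fun=> 1) (a, b)) a b;
  alpha_gt0 : forall j, 0 < alpha j;
  traffic : forall j, alpha j = nu j + \sum_i alpha i * lam i j }.

Definition queue_state (J : nat) := {ffun 'I_J -> nat}.

(* Queue lengths together with the number of transitions made along each
   link.  Keeping the counts is necessary because a transition from j to j does
   not change the queue lengths. *)
Definition flow_state (J : nat) :=
  (queue_state J * {ffun link J -> nat})%type.

Section network.
Context {R : realType} {J : nat} (net : jackson_network R J).

Definition rho : link J -> R :=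
  link_weight (nu net) (lam net) (mu net) (alpha net).

Definition transition_rate (n : queue_state J) : link J -> R :=
  link_weight (nu net) (lam net) (mu net) (fun j => phi net j (n j)).

(* n - e_j + e_k for l = (j, k), with e_0 = 0; the truncated subtraction is
   harmless because [transition_rate n (Some j, _) = 0] when [n j = 0]. *)
Definition move_customer (n : queue_state J) (l : link J) : queue_state J :=
  [ffun i => (n i - (Some i == l.1) + (Some i == l.2))%N].

Definition equilibrium_weight (j : 'I_J) (k : nat) : R :=
  alpha net j ^+ k / \prod_(1 <= r < k.+1) phi net j r.

Definition equilibrium_norm (j : 'I_J) : \bar R :=
  (\sum_(0 <= k <oo) (equilibrium_weight j k)%:E)%E.

Definition flow_rate (x y : flow_state J) : R :=
  \sum_(l : link J)
    if (y.1 == move_customer x.1 l) && (y.2 == [ffun l' => x.2 l' + (l' == l)]%N)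
    then transition_rate x.1 l else 0.

End network.

Section markov.
Context {R : realType} {T : choiceType}.

Record transition_function (p : R -> T -> T -> R) : Prop := TransitionFunction {
  transition_ge0 : forall h x y, 0 <= h -> 0 <= p h x y;
  transition_sum1 : forall h x, 0 <= h ->
    (\esum_(y in [set: T]) (p h x y)%:E = 1)%E;
  transition0 : forall x y, p 0 x y = (x == y)%:R;
  transitionD : forall h h' x z, 0 <= h -> 0 <= h' ->
    (p (h + h') x z)%:E = (\esum_(y in [set: T]) (p h x y * p h' y z)%:E)%E }.

(* p is standard with (conservative) off-diagonal rates q. *)
Definition has_rates (p : R -> T -> T -> R) (q : T -> T -> R) : Prop :=
  (forall x y, x != y -> p h x y / h @[h --> 0^'+] --> q x y) /\
  (forall x, (\esum_(y in [set~ x]) (q x y)%:E < +oo)%E /\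
    (1 - p h x x) / h @[h --> 0^'+] -->
      fine (\esum_(y in [set~ x]) (q x y)%:E)%E).

Definition markov_from d (Omega : measurableType d) (P : probability Omega R)
    (p : R -> T -> T -> R) (s : R) (X : R -> Omega -> T) : Prop :=
  forall (m : nat) (u : nat -> R) (x : nat -> T),
    s <= u 0%N -> (forall i, u i <= u i.+1) ->
    P [set w | forall i, (i <= m)%N -> X (u i) w = x i] =
    (P [set w | X (u 0%N) w = x 0%N] *
     (\prod_(i < m) p (u i.+1 - u i) (x i) (x i.+1))%:E)%E.

End markov.

(* Point measures on R x S: nonnegative integer-valued on Borel sets that are
   bounded in time. *)
Record point_measure (R : realType) (J : nat) := PointMeasure {
  pm_measure :> {measure set (flow_space R J) -> \bar R};
  pm_nat : forall (r : R) (B : set (flow_space R J)), measurable B ->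
    (forall x, B x -> `|x.1| <= r) ->
    exists n : nat, pm_measure B = n%:R%:E }.

Section point_measure_type.
Context (R : realType) (J : nat).

Lemma mzero_nat (r : R) (B : set (flow_space R J)) : measurable B ->
  (forall x, B x -> `|x.1| <= r) ->
  exists n : nat, @mzero _ (flow_space R J) R B = n%:R%:E.
Proof. by move=> _ _; exists 0%N. Qed.

HB.instance Definition _ := gen_eqMixin (point_measure R J).
HB.instance Definition _ := gen_choiceMixin (point_measure R J).
HB.instance Definition _ :=
  isPointed.Build (point_measure R J) (PointMeasure mzero_nat).

Definition count_events : set (set (point_measure R J)) :=
  [set E | exists (B : set (flow_space R J)) (i : nat),
     measurable B /\ E = [set xi : point_measure R J | xi B = i%:R%:E]].

Definition point_measures : measurableType count_events.-sigma :=
  g_sigma_algebraType count_events.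

End point_measure_type.

(* Gamma_{C,t} *)
Definition window (R : realType) (J : nat) (C : {set link J}) (t : R) :
    set (flow_space R J) :=
  [set x | 0 <= x.1 <= t /\ x.2 \in C].

(* H_{C,t}: a measure on Gamma_{C,t} is encoded as a measure on R x S that
   vanishes off Gamma_{C,t}. *)
Record window_measure (R : realType) (J : nat) (C : {set link J}) (t : R) :=
  WindowMeasure {
  wm_measure :> {measure set (flow_space R J) -> \bar R};
  wm_nat : forall B : set (flow_space R J), measurable B ->
    exists n : nat, wm_measure B = n%:R%:E;
  wm_support : wm_measure (~` window C t) = 0%E }.

Section window_measure_type.
Context (R : realType) (J : nat) (C : {set link J}) (t : R).

Lemma mzero_window_nat (B : set (flow_space R J)) : measurable B ->
  exists n : nat, @mzero _ (flow_space R J) R B = n%:R%:E.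
Proof. by move=> _; exists 0%N. Qed.

Lemma mzero_window_support :
  @mzero _ (flow_space R J) R (~` window C t) = 0%E.
Proof. by []. Qed.

HB.instance Definition _ := gen_eqMixin (window_measure C t).
HB.instance Definition _ := gen_choiceMixin (window_measure C t).
HB.instance Definition _ := isPointed.Build (window_measure C t)
  (WindowMeasure mzero_window_nat mzero_window_support).

Definition window_count_events : set (set (window_measure C t)) :=
  [set E | exists (B : set (flow_space R J)) (i : nat),
     [/\ measurable B, B `<=` window C t &
       E = [set xi : window_measure C t | xi B = i%:R%:E]]].

(* H_{C,t} equipped with the sigma-algebra of the same name *)
Definition window_measures : measurableType window_count_events.-sigma :=
  g_sigma_algebraType window_count_events.

End window_measure_type.
Arguments window_measures {R J} C t.

Section operations.
Context {R : realType} {J : nat}.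
Implicit Types (xi : point_measures R J) (C : {set link J}) (s t : R).

Definition translate s (x : flow_space R J) : flow_space R J :=
  ((x.1 : R) + s, x.2).

Lemma measurable_translate s : measurable_fun setT (translate s).
Proof.
apply/measurable_fun_pairP; split => /=; last exact: measurable_snd.
apply: (@measurableT_comp _ _ _ _ _ _ (fun x : measurableTypeR R => (x : R) + s));
  last exact: measurable_fst.
exact: measurable_funD.
Qed.

Lemma measurable_link_set (D : set (link J)) : measurable D.
Proof.
rewrite (_ : D = \bigcup_(l in D) ([set l.1] `*` [set l.2])).
  apply: fin_bigcup_measurable => [|l _]; first exact: finite_finset.
  exact: measurableX.
apply/seteqP; split => [l Dl|l [l' Dl' [/= e1 e2]]]; first by exists l.
by rewrite (surjective_pairing l) e1 e2 -surjective_pairing.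
Qed.

Lemma measurable_window C t : measurable (window C t).
Proof.
rewrite (_ : window C t = `[0, t] `*` [set` C]).
  by apply: measurableX; [exact: measurable_itv|exact: measurable_link_set].
by apply/seteqP; split => x; rewrite /window/= in_itv/=.
Qed.

Lemma window_bounded C t x : window C t x -> `|x.1| <= t.
Proof. by move=> [/andP[x0 xt] _]; rewrite ger0_norm. Qed.


(* Every point moved by +s in time. *)
Definition translate_measure s xi : {measure set (flow_space R J) -> \bar R}.
Proof.
refine (pushforward xi (translate s) : {measure set (flow_space R J) -> \bar R}).
exact: measurable_translate.
Defined.

Lemma translate_nat s xi (r : R) (B : set (flow_space R J)) : measurable B ->
  (forall x, B x -> `|x.1| <= r) ->
  exists n : nat, translate_measure s xi B = n%:R%:E.
Proof.
move=> mB rB; apply: (@pm_nat _ _ xi (r + `|s|)).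
  by rewrite -[X in measurable X]setTI; exact: measurable_translate.
move=> x /rB /= xr; rewrite -[X in `|X|](addrK s).
by rewrite (le_trans (ler_normB _ _))// lerD2r.
Qed.

Definition translate_pm s xi : point_measures R J :=
  PointMeasure (translate_nat s xi).

Lemma add_nat xi xi' (r : R) (B : set (flow_space R J)) : measurable B ->
  (forall x, B x -> `|x.1| <= r) ->
  exists n : nat, measure_add xi xi' B = n%:R%:E.
Proof.
move=> mB rB; have [m Em] := pm_nat xi mB rB; have [n En] := pm_nat xi' mB rB.
by exists (m + n)%N; rewrite measure_addE Em En natrD.
Qed.

Definition add_pm xi xi' : point_measures R J := PointMeasure (add_nat xi xi').

(* The number of points in B, when B is bounded in time. *)
Definition npoints xi (B : set (flow_space R J)) : nat := Num.truncn (fine (xi B)).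

Lemma restrict_nat C t xi (B : set (flow_space R J)) : measurable B ->
  exists n : nat, mrestr xi (measurable_window C t) B = n%:R%:E.
Proof.
move=> mB; apply: (@pm_nat _ _ xi t).
  by apply: measurableI => //; exact: measurable_window.
by move=> x [_]; exact: window_bounded.
Qed.

Lemma restrict_support C t xi :
  mrestr xi (measurable_window C t) (~` window C t) = 0%E.
Proof. by rewrite /mrestr setICl measure0. Qed.

Definition restrict_window C t xi : window_measures C t :=
  WindowMeasure (@restrict_nat C t xi) (@restrict_support C t xi).

Lemma sum_window_nat C t (eta : nat -> window_measures C t) n
    (B : set (flow_space R J)) : measurable B ->
  exists m : nat, msum eta n B = m%:R%:E.
Proof.
move=> mB; elim: n => [|n [m IH]]; first by exists 0%N; rewrite /msum big_ord0.
have [k Ek] := wm_nat (eta n) mB.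
by exists (m + k)%N; move: IH; rewrite /msum big_ord_recr/= => ->; rewrite Ek natrD.
Qed.

Lemma sum_window_support C t (eta : nat -> window_measures C t) n :
  msum eta n (~` window C t) = 0%E.
Proof. by rewrite /msum big1// => i _; exact: wm_support. Qed.

(* eta 0 + ... + eta (n - 1) *)
Definition sum_window C t (eta : nat -> window_measures C t) n :
    window_measures C t :=
  WindowMeasure (sum_window_nat eta n) (sum_window_support eta n).

End operations.

Section probability.
Context {R : realType} {d : measure_display} {Omega : measurableType d}.
Variable P : probability Omega R.

Definition independent2 d1 d2 (T1 : measurableType d1) (T2 : measurableType d2)
    (X : Omega -> T1) (Y : Omega -> T2) : Prop :=
  forall A B, measurable A -> measurable B ->
    P (X @^-1` A `&` Y @^-1` B) = (P (X @^-1` A) * P (Y @^-1` B))%E.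

Definition iid d1 (T1 : measurableType d1) (X : nat -> Omega -> T1) : Prop :=
  [/\ forall i, measurable_fun setT (X i),
    forall i A, measurable A -> P (X i @^-1` A) = P (X 0%N @^-1` A) &
    forall n (A : nat -> set T1), (forall i, measurable (A i)) ->
      P (\bigcap_(i < n) (X i @^-1` A i)) = (\prod_(i < n) P (X i @^-1` A i))%E].

Definition independent_of_sequence d1 d2 (T1 : measurableType d1)
    (T2 : measurableType d2) (Y : Omega -> T1) (X : nat -> Omega -> T2) : Prop :=
  forall n (A : nat -> set T2) B, (forall i, measurable (A i)) -> measurable B ->
    P (Y @^-1` B `&` \bigcap_(i < n) (X i @^-1` A i)) =
    (P (Y @^-1` B) * P (\bigcap_(i < n) (X i @^-1` A i)))%E.

End probability.

Section flow.
Context {R : realType} {J : nat} {d : measure_display}.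
Context {Omega : measurableType d} (P : probability Omega R).

Definition flow_counts (N : R -> Omega -> queue_state J)
    (Xi : Omega -> point_measures R J) (s u : R) (w : Omega) : flow_state J :=
  (N u w, [ffun l => npoints (Xi w) (`]s, u] `*` [set l])]).

(* N is the queue length process, in equilibrium on the whole line, and Xi the
   flow process.  The dynamics are those of the pair formed by N and the
   transition counts of Xi after time s, for every s. *)
Record jackson_flow (net : jackson_network R J)
    (N : R -> Omega -> queue_state J) (Xi : Omega -> point_measures R J) : Prop :=
  JacksonFlow {
  flow_measurable_N : forall t n, measurable [set w | N t w = n];
  flow_measurable_Xi : measurable_fun setT Xi;
  equilibrium_norm_fin : forall j, (equilibrium_norm net j < +oo)%E;
  flow_equilibrium : forall t (n : queue_state J),
    P [set w | N t w = n] =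
    (\prod_j (equilibrium_weight net j (n j) / fine (equilibrium_norm net j)))%:E;
  (* N changes only at the points of Xi, a point on (j, k) moving one customer
     from j to k; at j = k it is counted on both sides. *)
  flow_balance : {ae P, forall w, forall s u, s <= u -> forall j : 'I_J,
    (N u w j + \sum_(b : node J) npoints (Xi w) (`]s, u] `*` [set (Some j, b)]) =
     N s w j + \sum_(a : node J) npoints (Xi w) (`]s, u] `*` [set (a, Some j)]))%N};
  flow_markov : exists p : R -> flow_state J -> flow_state J -> R,
    [/\ transition_function p, has_rates p (flow_rate net) &
      forall s, markov_from P p s (flow_counts N Xi s)] }.

(* Q is the Palm distribution of Xi: for each A, (s, l) |-> Q (s, l) A is the
   density of E [1_[Xi \in A] Xi (.)] with respect to rho_l ds (with A = setT this
   says that rho_l ds is the mean measure of Xi), in the version compatible with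
   time shifts. *)
Definition palm_distribution (net : jackson_network R J)
    (Xi : Omega -> point_measures R J)
    (Q : R.-pker (flow_space R J) ~> point_measures R J) : Prop :=
  (forall (A : set (point_measures R J)) (B : set (flow_space R J)),
     measurable A -> measurable B ->
     (\int[P]_(w in Xi @^-1` A) Xi w B =
      \sum_(l : link J) \int[lebesgue_measure]_(s in [set s | B (s, l)])
        (Q (s, l) A * (rho net l)%:E))%E) /\
  (forall s l A, measurable A ->
     Q (s, l) A = Q (0, l) (translate_pm s @^-1` A)).

(* xi is a version of the extra-customer process at (0, l); its law is determined
   by this property. *)
Definition extra_customer (Xi : Omega -> point_measures R J)
    (Q : R.-pker (flow_space R J) ~> point_measures R J)
    (l : link J) (xi : Omega -> point_measures R J) : Prop :=
  [/\ measurable_fun setT xi, independent2 P xi Xi &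
    forall A, measurable A ->
      P [set w | A (add_pm (xi w) (Xi w))] = Q (0, l) A].

(* xi l is xi^(0,l), so xi^(s,l) is its translate by s; xi^(s,l) charges
   (s, l) almost surely, so that the convention 0^-1 = 0 is immaterial when
   rho l > 0, and the terms with rho l = 0 vanish. *)
Definition theta (net : jackson_network R J)
    (xi : link J -> Omega -> point_measures R J) (C : {set link J}) (t : R) : R :=
  fine (\int[P]_w \sum_(l in C) \int[lebesgue_measure]_(s in `[0%R, t])
    ((fine (translate_pm s (xi l w) (window C t)))^-1 * rho net l)%:E)%E.

End flow.

(* Main.v *)
Require Import Defs.
From HB Require Import structures.
From mathcomp Require Import all_boot all_order all_algebra.
From mathcomp Require Import all_classical all_reals all_analysis.
From mathcomp Require Import measurable_realfun ring lra.

Set Implicit Arguments.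
Unset Strict Implicit.
Unset Printing Implicit Defensive.

Import Order.TTheory GRing.Theory Num.Theory.
Import numFieldNormedType.Exports.

Local Open Scope classical_set_scope.
Local Open Scope ring_scope.

(** The law of a random point measure on a window is determined by an equation
that weighs it by its number of points.  Write [L] for the number of points of
a measure on the window and, given [theta > 0] and a probability [F] on the
measures on the window, consider the laws [mu] such that
<<  \int_A L dmu = theta * \int F(dy) L(y) mu {x | y + x \in A}   for all A. >>
This is a recursion of Panjer type: if [L = n > 0] on [A], the right-hand side
involves [mu] only on [{L < n}], because of the factor [L(y)].  Hence two
solutions are proportional level by level, so they are equal if they are
probabilities and one of them charges [{L = 0}] ([mass_equation_unique]).  The
induction starts at [L = 0] because no measurable set separates the measures
without points.

The compound Poisson law with parameter [theta] and summand law [F] is a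
solution ([compound_poisson_mass_equation]): by exchangeability, weighing a sum
of [m] independent summands by its mass amounts to [m] times weighing it by the
mass of the first summand, and [m] times the Poisson weight of [m] is [theta]
times that of [m - 1].

The law of the restricted flow is a solution as well ([flow_mass_equation]).
The Palm formula, applied to the whole window, turns [\int_A L dmu] into an
integral of the Palm probabilities of [A]; by the decomposition of the Palm
process into the flow plus an independent extra customer, these are averages of
[mu {x | y + x \in A}] over the restriction [y] of the extra process; and the
intensity of this restriction is [theta * L(y)] times the law of the summands.
Two facts are needed on the way:
- the law of the flow seen through a window does not change when the flow is
  shifted ([stationary_window]); it is enough that the Palm kernel is
  compatible with shifts, since the Palm kernel determines the law of the flow
  on [{L = n}] for each [n > 0];
- the extra process has almost surely a point in the window
  ([extra_customer_window_gt0]), so that dividing by its number of points loses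
  no mass.  For a window so short that the flow is empty there with positive
  probability, this follows by independence, because the Palm formula forces
  the sum of the flow and of the extra process to be nonempty; and each window
  [[-s, t - s]] with [0 < s < t] contains short windows of this kind. *)

(** * Laws, image measures and integrals *)

Section law.
Context d d' (T : measurableType d) (T' : measurableType d') (R : realType).
Variables (P : probability T R) (X : T -> T') (mX : measurable_fun setT X).

(** The law of a measurable map, as a bundled probability. *)
Definition law : probability T' R :=
  distribution P
    (HB.pack_for {mfun T >-> T'} X (isMeasurableFun.Build _ _ _ _ X mX)).

Lemma lawE A : law A = P (X @^-1` A). Proof. by []. Qed.

Lemma ge0_integral_law (f : T' -> \bar R) : measurable_fun setT f ->
  (forall y, 0 <= f y)%E -> (\int[law]_y f y = \int[P]_x f (X x))%E.
Proof. by move=> mf f0; rewrite ge0_integral_distribution. Qed.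

End law.

(** The push-forward of a measure, bundled with the measurability of the map. *)
Definition image_measure d d' (T : measurableType d) (T' : measurableType d')
  (R : realType) (m : {measure set T -> \bar R}) (f : T -> T')
  (mf : measurable_fun setT f) : {measure set T' -> \bar R}.
Proof. by refine (pushforward m f : {measure set T' -> \bar R}); exact: mf. Defined.

Lemma ge0_integral_image_measure d d' (T : measurableType d) (T' : measurableType d')
  (R : realType) (m : {measure set T -> \bar R}) (f : T -> T')
  (mf : measurable_fun setT f) (h : T' -> \bar R) :
  measurable_fun setT h -> (forall y, 0 <= h y)%E ->
  (\int[image_measure m mf]_y h y = \int[m]_x h (f x))%E.
Proof. by move=> mh h0; rewrite ge0_integral_pushforward. Qed.

Lemma measurable_preimageT d d' (T : measurableType d) (T' : measurableType d')
  (f : T -> T') A : measurable_fun setT f -> measurable A -> measurable (f @^-1` A).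
Proof. by move=> mf mA; rewrite -[X in measurable X]setTI; exact: mf. Qed.

Lemma integral_shift (R : realType) (u : R) (D : set R) (f : R -> \bar R) :
  measurable (D : set (measurableTypeR R)) ->
  measurable_fun (setT : set (measurableTypeR R)) f -> (forall s, 0 <= f s)%E ->
  (\int[lebesgue_measure]_(s in [set s | D (s + u)%R]) f (s + u)%R =
   \int[lebesgue_measure]_(s in D) f s)%E.
Proof.
move=> mD mf f0.
have mu : measurable_fun (setT : set (measurableTypeR R))
    (fun s : measurableTypeR R => (s + u : measurableTypeR R)).
  exact: measurable_funD.
transitivity (\int[image_measure (@lebesgue_measure R) mu]_(s in D) f s)%E.
  by rewrite ge0_integral_pushforward//; exact: measurable_funTS.
apply: eq_measure_integral => A mA _.
apply/esym/lebesgue_measure_unique => // _ [[a b]] _ <-.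
rewrite /image_measure/= /pushforward.
rewrite (_ : _ @^-1` _ = `]a - u, b - u]%classic).
  by rewrite !lebesgue_measure_itv/= !lte_fin ltrD2r -!EFinB opprB addrA subrK.
by apply/seteqP; split => s /=; rewrite !in_itv/= ltrBlDr lerBrDr.
Qed.

(** Integrating out [Y] when [X] and [Y] are independent: their joint law is the
product measure. *)
Lemma independent2_integral d d1 d2 (T : measurableType d) (T1 : measurableType d1)
  (T2 : measurableType d2) (R : realType) (P : probability T R)
  (X : T -> T1) (Y : T -> T2) (mX : measurable_fun setT X) (mY : measurable_fun setT Y)
  (D : set (T1 * T2)) :
  independent2 P X Y -> measurable D ->
  P [set w | D (X w, Y w)] = (\int[P]_w law P mY [set y | D (X w, y)])%E.
Proof.
move=> XY mD.
have rect A B : measurable A -> measurable B ->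
    image_measure P (measurable_fun_pair mX mY) (A `*` B) = (law P mX A * law P mY B)%E.
  by move=> mA mB; exact: (XY A B mA mB).
transitivity ((law P mX \x law P mY)%E D).
  by rewrite (product_measure_unique rect mD).
transitivity (\int[law P mX]_x law P mY (xsection D x))%E; first by [].
rewrite ge0_integral_law//; last exact: measurable_fun_xsection.
apply: eq_integral => w _; congr (law P mY _).
by apply/seteqP; split => y; rewrite /xsection/= ?inE//= => /set_mem.
Qed.

Lemma ge0_integral_mrestr d (T : measurableType d) (R : realType)
  (m : {measure set T -> \bar R}) D (mD : measurable D) (f : T -> \bar R) :
  measurable_fun setT f -> (forall x, 0 <= f x)%E ->
  (\int[mrestr m mD]_x f x = \int[m]_(x in D) f x)%E.
Proof.
move=> mf f0; have mCD := measurableC mD.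
rewrite (@ge0_negligible_integral _ _ _ _ setT (~` D))//; last first.
  by rewrite /= /mrestr setICl measure0.
rewrite setTD setCK; apply: eq_measure_integral => A mA AD /=.
by rewrite /mrestr setIidl.
Qed.

(** A finite nonnegative combination of measures is a measure, and integrals are
combined with the same weights. *)
Lemma finite_combination_measure d (T : measurableType d) (R : realType) (I : Type)
  (s : seq I) (c : I -> R) (m : I -> {measure set T -> \bar R}) :
  (forall i, 0 <= c i) ->
  exists M : {measure set T -> \bar R},
    (forall A, measurable A -> M A = \sum_(i <- s) (c i)%:E * m i A)%E /\
    (forall f, measurable_fun setT f -> (forall x, 0 <= f x)%E ->
      \int[M]_x f x = \sum_(i <- s) (c i)%:E * \int[m i]_x f x)%E.
Proof.
move=> c0; elim: s => [|i s [M [MA Mf]]].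
  by exists mzero; split=> [A mA|f mf f0]; rewrite big_nil ?integral_measure_zero.
exists (measure_add (mscale (NngNum (c0 i)) (m i)) M); split=> [A mA|f mf f0].
  by rewrite big_cons -MA//; exact: measure_addE.
rewrite big_cons -Mf// ge0_integral_measure_add//.
by congr (_ + _)%E; rewrite ge0_integral_mscale.
Qed.

(** * Measurable monoids with an integer mass *)

Section counting_monoid.
Context d (H : measurableType d) (R : realType).
Variables (add : H -> H -> H) (zero : H) (L : H -> nat).

(** A measurable commutative monoid with an integer-valued additive mass [L].
The last field says that no measurable set separates two elements of mass 0; on
point measures this is all that holds, because a measure is a function of all
sets and its values on nonmeasurable sets are arbitrary. *)
Record counting_monoid : Prop := CountingMonoid {
  measurable_add : measurable_fun setT (fun x : H * H => add x.1 x.2);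
  measurable_level : forall n, measurable [set x | L x = n];
  addmA : associative add;
  addmC : commutative add;
  add0m : left_id zero add;
  mass_add : forall x y, L (add x y) = (L x + L y)%N;
  mass_zero : L zero = 0%N;
  mass_eq0 : forall A, measurable A -> forall x, L x = 0%N -> A x <-> A zero }.

(** The mass as an extended real. *)
Definition mass (x : H) : \bar R := (L x)%:R%:E.

Lemma mass_ge0 x : (0 <= mass x)%E.
Proof. by rewrite lee_fin. Qed.

Hypothesis HM : counting_monoid.

Lemma measurable_fun_add d1 (T1 : measurableType d1) (f g : T1 -> H) :
  measurable_fun setT f -> measurable_fun setT g ->
  measurable_fun setT (fun x => add (f x) (g x)).
Proof.
by move=> mf mg; exact: measurableT_comp (measurable_add HM) (measurable_fun_pair mf mg).
Qed.

Lemma measurable_addl y : measurable_fun setT (add y).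
Proof.
apply: (measurable_fun_pair2 (f := fun p : H * H => add p.1 p.2)).
exact: measurable_add HM.
Qed.

Lemma measurable_mass : measurable_fun setT mass.
Proof.
apply/measurable_EFinP => _ B mB; rewrite setTI.
rewrite (_ : _ @^-1` _ =
    \bigcup_(n in [set n : nat | B n%:R]) [set x | L x = n]).
  by apply: bigcup_measurable => n _; exact: measurable_level HM n.
by apply/seteqP; split => [x /= Bx|x [n /= Bn ->]//]; exists (L x).
Qed.

Section convolution.
Variable F : probability H R.

(** The convolution of [F] and [G]: the law of [y + x], with [y] of law [F] and [x]
of law [G] independent. *)
Definition conv (G : probability H R) : probability H R :=
  law ((F \x G)%E : probability (H * H)%type R) (measurable_add HM).

Lemma ge0_integral_conv G (h : H -> \bar R) : measurable_fun setT h ->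
  (forall x, 0 <= h x)%E ->
  (\int[conv G]_x h x = \int[F]_y \int[G]_x h (add y x))%E.
Proof.
move=> mh h0; rewrite ge0_integral_law//.
rewrite (@fubini_tonelli1 _ _ _ _ _ F G (fun z => h (add z.1 z.2)))//.
exact: measurableT_comp mh (measurable_add HM).
Qed.

(** The [n]-fold convolution power of [F]. *)
Fixpoint conv_power n : probability H R :=
  if n is n'.+1 then conv (conv_power n') else \d_zero.

Lemma conv_powerS n : conv_power n.+1 = conv (conv_power n).
Proof. by []. Qed.

(** The mass is a derivation for the convolution: weighing a sum of [m + 1]
summands by its mass amounts to [m + 1] times weighing it by the mass of one of
them.  By induction, exchanging the roles of two summands by Fubini. *)
Lemma integral_conv_power_mass m (h : H -> \bar R) : measurable_fun setT h ->
  (forall x, 0 <= h x)%E ->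
  (\int[conv_power m.+1]_x (mass x * h x) =
   m.+1%:R%:E * \int[F]_y (mass y * \int[conv_power m]_x h (add y x)))%E.
Proof.
have madd := measurable_add HM.
elim: m h => [|m IH] h mh h0.
- rewrite mul1e conv_powerS ge0_integral_conv; first last.
  + by move=> x; rewrite mule_ge0// mass_ge0.
  + by apply: emeasurable_funM => //; exact: measurable_mass.
  apply: eq_integral => y _.
  have mhy : measurable_fun setT (fun x => h (add y x)).
    exact: measurableT_comp mh (measurable_addl y).
  rewrite !integral_dirac ?diracT ?mul1e//.
    by rewrite /mass (mass_add HM) (mass_zero HM) addn0.
  apply: emeasurable_funM => //.
  exact: (measurableT_comp measurable_mass (measurable_addl y)).
- have mhy y : measurable_fun setT (fun x => h (add y x)).
    exact: measurableT_comp mh (measurable_addl y).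
  have mI (G : probability H R) : measurable_fun setT (fun y => \int[G]_x h (add y x))%E.
    apply: (@measurable_fun_fubini_tonelli_F _ _ _ _ _ _ (fun z => h (add z.1 z.2))) => //.
    exact: measurableT_comp mh madd.
  have I0 (G : probability H R) y : (0 <= \int[G]_x h (add y x))%E by exact: integral_ge0.
  have mMI (G : probability H R) :
      measurable_fun setT (fun y => mass y * \int[G]_x h (add y x))%E.
    by apply: emeasurable_funM; [exact: measurable_mass|exact: (mI G)].
  rewrite conv_powerS ge0_integral_conv; first last.
  + by move=> x; rewrite mule_ge0// mass_ge0.
  + by apply: emeasurable_funM => //; exact: measurable_mass.
  transitivity (\int[F]_y (mass y * \int[conv_power m.+1]_x h (add y x) +
      m.+1%:R%:E * \int[F]_z (mass z * \int[conv_power m]_x h (add y (add z x)))))%E.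
    apply: eq_integral => y _.
    under eq_integral do rewrite {1}/mass (mass_add HM) natrD EFinD ge0_muleDl//.
    rewrite ge0_integralD//; first last.
    + by apply: emeasurable_funM => //; exact: measurable_mass.
    + by move=> x _; rewrite mule_ge0// lee_fin.
    + by apply: emeasurable_funM => //.
    + by move=> x _; rewrite mule_ge0// lee_fin.
    rewrite (IH _ (mhy y))//.
    congr (_ + _)%E.
    by rewrite ge0_integralZl.
  have mMM y : measurable_fun setT (fun z =>
      mass z * \int[conv_power m]_x h (add y (add z x)))%E.
    apply: emeasurable_funM; first exact: measurable_mass.
    apply: (@measurable_fun_fubini_tonelli_F _ _ _ _ _ _
      (fun p => h (add y (add p.1 p.2)))) => //.
    exact: measurableT_comp (mhy y) madd.
  have I2 y z : (0 <= mass z * \int[conv_power m]_x h (add y (add z x)))%E.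
    by rewrite mule_ge0 ?mass_ge0//; exact: integral_ge0.
  have mJ : measurable_fun setT (fun p : H * H =>
      mass p.2 * \int[conv_power m]_x h (add p.1 (add p.2 x)))%E.
    apply: emeasurable_funM; first exact: measurableT_comp measurable_mass measurable_snd.
    apply: (@measurable_fun_fubini_tonelli_F _ _ _ _ _ _
      (fun p => h (add p.1.1 (add p.1.2 p.2)))) => //.
    apply: measurableT_comp mh _.
    apply: measurable_fun_add; first exact: measurableT_comp measurable_fst measurable_fst.
    apply: measurable_fun_add; last exact: measurable_snd.
    exact: measurableT_comp measurable_snd measurable_fst.
  have mK : measurable_fun setT (fun y =>
      \int[F]_z (mass z * \int[conv_power m]_x h (add y (add z x))))%E.
    exact: (@measurable_fun_fubini_tonelli_F _ _ _ _ _ _ (fun p : H * H =>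
      mass p.2 * \int[conv_power m]_x h (add p.1 (add p.2 x)))%E).
  rewrite ge0_integralD//; first last.
  + exact: measurable_funeM.
  + by move=> y _; rewrite mule_ge0//; exact: integral_ge0.
  + by move=> y _; rewrite mule_ge0 ?mass_ge0.
  rewrite ge0_integralZl//; last by move=> y _; exact: integral_ge0.
  (* exchange the first two summands *)
  have -> : (\int[F]_y \int[F]_z (mass z * \int[conv_power m]_x h (add y (add z x))) =
      \int[F]_z (mass z * \int[conv_power m.+1]_x h (add z x)))%E.
    rewrite (fubini_tonelli (fun p : H * H =>
      mass p.2 * \int[conv_power m]_x h (add p.1 (add p.2 x)))%E)//.
    apply: eq_integral => z _ /=.
    rewrite ge0_integralZl//; first last.
    + by rewrite mass_ge0.
    + by move=> y _; exact: integral_ge0.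
    + apply: (@measurable_fun_fubini_tonelli_F _ _ _ _ _ _
        (fun p => h (add p.1 (add z p.2)))) => //.
      apply: measurableT_comp mh _; apply: measurable_fun_add; first exact: measurable_fst.
      by apply: measurable_fun_add => //; exact: measurable_snd.
    rewrite ge0_integral_conv//; congr (_ * _)%E.
    apply: eq_integral => y _; apply: eq_integral => x _.
    by rewrite !(addmA HM) (addmC HM y).
  by rewrite -[X in (X + _)%E]mul1e -ge0_muleDl ?lee_fin// -EFinD.
Qed.

Section partial_sums.
Context d1 (T : measurableType d1) (P : probability T R).

(** The sum of the first [n] terms of a sequence of random elements. *)
Fixpoint partial_sum (X : nat -> T -> H) n w : H :=
  if n is n'.+1 then add (X 0%N w) (partial_sum (fun i => X i.+1) n' w) else zero.

Lemma measurable_partial_sum (X : nat -> T -> H) n :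
  (forall i, measurable_fun setT (X i)) -> measurable_fun setT (partial_sum X n).
Proof.
elim: n X => [|n IH] X mX /=; first exact: measurable_cst.
by apply: measurable_fun_add => //; exact: IH.
Qed.

(** If, on the event [E], the [X i] are independent with law [F] and independent of
[E], then the partial sums have the convolution powers of [F] as laws.  The
induction splits off the first summand, which is added to the event [E]. *)
Lemma partial_sum_conv_power (X : nat -> T -> H) (E : set T) k A :
  (forall i, measurable_fun setT (X i)) -> measurable E ->
  (forall n (B : nat -> set H), (forall i, measurable (B i)) ->
    P (E `&` \bigcap_(i < n) (X i @^-1` B i)) = (P E * \prod_(i < n) F (B i))%E) ->
  measurable A ->
  P (E `&` partial_sum X k @^-1` A) = (P E * conv_power k A)%E.
Proof.
elim: k X E A => [|k IH] X E A mX mE indep mA /=.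
  rewrite diracE; have [zA|zA] := boolP (zero \in A).
    rewrite mule1 (_ : _ @^-1` A = setT) ?setIT//.
    by apply/seteqP; split => // w _; exact: set_mem.
  rewrite mule0 (_ : _ @^-1` A = set0) ?setI0 ?measure0//.
  by apply/seteqP; split => // w Aw; move: zA; rewrite mem_set.
have mS := measurable_partial_sum k (fun i => mX i.+1).
have rect B C : measurable B -> measurable C ->
    (P (E `&` X 0%N @^-1` B `&` partial_sum (fun i => X i.+1) k @^-1` C) =
     P E * F B * conv_power k C)%E.
  move=> mB mC.
  have PEB : (P (E `&` X 0%N @^-1` B) = P E * F B)%E.
    have := indep 1%N (fun=> B) (fun=> mB).
    by rewrite bigcap_mkord !big_ord1.
  rewrite IH ?PEB//; first by apply: measurableI => //; exact: measurable_preimageT.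
  move=> n D mD; have := indep n.+1 (fun i => if i is i'.+1 then D i' else B).
  rewrite big_ord_recl/= muleA => <-; last by case.
  by rewrite !bigcap_mkord big_ord_recl/= setIA.
have [PE0|PE0] := eqVneq (P E) 0%E.
  rewrite PE0 mul0e; apply/eqP; rewrite -measure_le0 -PE0.
  rewrite le_measure ?inE//; apply: measurableI => //.
  by apply: measurable_preimageT => //; apply: measurable_fun_add.
have PEfin : P E \is a fin_num by exact: fin_num_measure.
have p_gt0 : 0 < fine (P E).
  by rewrite fine_gt0// lt0e PE0 measure_ge0 -ge0_fin_numE.
(* the joint law of [X 0] and of the sum of the next [k] terms, given [E], is
   the product law since it is so on rectangles *)
have pVge0 : 0 <= (fine (P E))^-1 by rewrite invr_ge0 ltW.
have pV : (((fine (P E))^-1)%:E * P E = 1)%E.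
  by rewrite -[X in (_ * X)%E](fineK PEfin) -EFinM mulVf ?gt_eqF.
have mpair := measurable_fun_pair (mX 0%N) mS.
pose m0 := image_measure (mrestr P mE) mpair.
pose m' : {measure set (H * H) -> \bar R} := mscale (NngNum pVge0) m0.
have m'E B C : measurable B -> measurable C -> m' (B `*` C) = (F B * conv_power k C)%E.
  move=> mB mC.
  transitivity (((fine (P E))^-1)%:E * P (E `&` X 0%N @^-1` B
      `&` partial_sum (fun i => X i.+1) k @^-1` C))%E.
    by rewrite -setIA (setIC E).
  by rewrite rect// -(muleA (P E)) (muleA _ (P E)) pV mul1e.
have mD : measurable ((fun x : H * H => add x.1 x.2) @^-1` A).
  by apply: measurable_preimageT => //; exact: measurable_add HM.
transitivity (P E * (F \x conv_power k)%E
    ((fun x : H * H => add x.1 x.2) @^-1` A))%E; last by [].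
rewrite (product_measure_unique m'E mD).
transitivity (P E * (((fine (P E))^-1)%:E *
    P (E `&` (fun w => add (X 0%N w) (partial_sum (fun i => X i.+1) k w)) @^-1` A)))%E.
  by rewrite muleA (muleC (P E)) pV mul1e.
by rewrite (setIC E).
Qed.

End partial_sums.
End convolution.
End counting_monoid.
Arguments mass {d H R} L x.

Section levels.
Context d (H : measurableType d) (R : realType).
Variables (add : H -> H -> H) (zero : H) (L : H -> nat).
Hypothesis HM : counting_monoid add zero L.

(** Splitting a measure, then an integral, according to the value of the mass. *)
Lemma measure_levels (mu : {measure set H -> \bar R}) A : measurable A ->
  mu A = (\sum_(n <oo) mu (A `&` [set x | L x = n]))%E.
Proof.
move=> mA; rewrite -measure_semi_bigcup//.
- rewrite -setI_bigcupr (_ : \bigcup_n _ = setT) ?setIT//.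
  by apply/seteqP; split => // x _; exists (L x).
- by move=> n; apply: measurableI => //; exact: measurable_level HM n.
- apply/trivIsetP => i j _ _ ij; apply/seteqP; split => x //= [[_ Li] [_ Lj]].
  by move: ij; rewrite -Li -Lj eqxx.
- apply: bigcup_measurable => n _; apply: measurableI => //.
  exact: measurable_level HM n.
Qed.

Lemma integral_mass_level (mu : probability H R) n A : measurable A ->
  A `<=` [set x | L x = n] -> (\int[mu]_(x in A) mass L x = n%:R%:E * mu A)%E.
Proof.
move=> mA An; transitivity (\int[mu]_(x in A) cst (n%:R%:E : \bar R) x)%E.
  by apply: eq_integral => x /set_mem/An; rewrite /mass => ->.
exact: integral_cst.
Qed.

Lemma ge0_integral_levels (m : {measure set H -> \bar R}) f :
  measurable_fun setT f -> (forall x, 0 <= f x)%E ->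
  (\int[m]_x f x = \sum_(n <oo) \int[m]_(x in [set x | L x = n]) f x)%E.
Proof.
move=> mf f0.
have UT : \bigcup_n [set x | L x = n] = setT.
  by apply/seteqP; split => // x _; exists (L x).
rewrite -UT ge0_integral_bigcup//.
- exact: measurable_level HM.
- by rewrite UT.
- apply/trivIsetP => i j _ _ ij; apply/seteqP; split => x //= [Li Lj].
  by move: ij; rewrite -Li -Lj eqxx.
Qed.

(** A probability is determined by its density with respect to the mass: this
density gives it on the levels [L = n] with [n > 0], hence the probability of
the level 0, whose only measurable subsets are itself and the empty set. *)
Lemma eq_mass_integral (mu nu : probability H R) :
  (forall A, measurable A ->
    \int[mu]_(x in A) mass L x = \int[nu]_(x in A) mass L x)%E ->
  forall A, measurable A -> mu A = nu A.
Proof.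
move=> munu.
have pos n A : measurable A -> A `<=` [set x | L x = n.+1] -> mu A = nu A.
  move=> mA An; have := munu _ mA; rewrite !(integral_mass_level _ mA An).
  rewrite -(fineK (fin_num_measure mu _ mA)) -(fineK (fin_num_measure nu _ mA)).
  by rewrite -!EFinM => -[/mulfI] -> //; rewrite pnatr_eq0.
have mL n := measurable_level HM n.
have L0 : mu [set x | L x = 0%N] = nu [set x | L x = 0%N].
  have mC := measurableC (mL 0%N).
  rewrite -(setCK [set x | L x = 0%N]) (probability_setC mu mC) (probability_setC nu mC).
  congr (1 - _)%E.
  rewrite (measure_levels mu mC) (measure_levels nu mC).
  apply: eq_eseriesr => -[|n] _; first by rewrite setICl !measure0.
  by apply: (pos n); [exact: measurableI|exact: subIsetr].
move=> A mA; rewrite (measure_levels mu mA) (measure_levels nu mA).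
apply: eq_eseriesr => -[|n] _; last first.
  by apply: (pos n); [exact: measurableI|exact: subIsetr].
have [A0|A0] := pselect (A zero).
  rewrite setIidr// => x Lx; exact/(mass_eq0 HM mA Lx).
rewrite (_ : _ `&` _ = set0) ?measure0//.
by apply/seteqP; split=> x //= [Ax Lx]; apply: A0; exact/(mass_eq0 HM mA Lx).
Qed.

(** A measure with density [theta * L] with respect to [F] on each level has this
density everywhere. *)
Lemma mass_density_integral (theta : R) (F : probability H R)
  (M : {measure set H -> \bar R}) : 0 <= theta ->
  (forall n A, measurable A -> A `<=` [set x | L x = n] ->
    M A = (n%:R * theta)%:E * F A)%E ->
  forall h, measurable_fun setT h -> (forall x, 0 <= h x)%E ->
  (\int[M]_x h x = theta%:E * \int[F]_x (mass L x * h x))%E.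
Proof.
move=> th0 MF h mh h0.
have mm : measurable_fun setT (fun x => mass L x * h x : \bar R)%E.
  by apply: emeasurable_funM => //; exact: measurable_mass HM.
have m0 x : (0 <= mass L x * h x :> \bar R)%E by rewrite mule_ge0 ?mass_ge0.
rewrite (ge0_integral_levels M)// (ge0_integral_levels F)// -nneseriesZl; last first.
  by move=> n _; exact: integral_ge0.
apply: eq_eseriesr => n _.
have mn := measurable_level HM n.
have c0 : 0 <= n%:R * theta by rewrite mulr_ge0.
transitivity (\int[mscale (NngNum c0) F]_(x in [set x | L x = n]) h x)%E.
  by apply: eq_measure_integral => A mA An; rewrite (MF n).
rewrite ge0_integral_mscale//; last exact: measurable_funTS.
rewrite /= mulrC EFinM -muleA; congr (_ * _)%E.
rewrite -ge0_integralZl//; last exact: measurable_funTS.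
by apply: eq_integral => x /set_mem/= Ln; rewrite /mass Ln.
Qed.

End levels.

Section random_sum.
Context d (H : measurableType d) (R : realType).
Variables (add : H -> H -> H) (zero : H) (L : H -> nat).
Hypothesis HM : counting_monoid add zero L.
Context d1 (T : measurableType d1) (P : probability T R).
Variables (X : nat -> T -> H) (M : T -> nat).
Hypotheses (mX : forall i, measurable_fun setT (X i))
  (mM : forall k, measurable (M @^-1` [set k])).

Let random_sum_preimage A : (fun w => partial_sum add zero X (M w) w) @^-1` A =
  \bigcup_k (M @^-1` [set k] `&` partial_sum add zero X k @^-1` A).
Proof.
apply/seteqP; split => [w Aw|w [k _ [/= <-]]//].
by exists (M w).
Qed.

Lemma measurable_random_sum :
  measurable_fun setT (fun w => partial_sum add zero X (M w) w).
Proof.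
move=> _ A mA; rewrite setTI random_sum_preimage; apply: bigcup_measurable => k _.
apply: measurableI => //; apply: measurable_preimageT => //.
exact: (measurable_partial_sum HM).
Qed.

(** The law of a sum of a random number [M] of independent terms of law [F],
independent of [M]. *)
Lemma random_sum_law (F : probability H R) A :
  (forall k n (B : nat -> set H), (forall i, measurable (B i)) ->
    P (M @^-1` [set k] `&` \bigcap_(i < n) (X i @^-1` B i)) =
    (P (M @^-1` [set k]) * \prod_(i < n) F (B i))%E) ->
  measurable A ->
  law P measurable_random_sum A =
  (\sum_(k <oo) P (M @^-1` [set k]) * conv_power HM F k A)%E.
Proof.
move=> indep mA; rewrite [LHS]lawE random_sum_preimage.
have mE k : measurable (M @^-1` [set k] `&` partial_sum add zero X k @^-1` A).
  apply: measurableI => //; apply: measurable_preimageT => //.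
  exact: (measurable_partial_sum HM).
rewrite measure_semi_bigcup//.
- apply: eq_eseriesr => k _.
  exact: (partial_sum_conv_power HM k mX (mM k) (indep k) mA).
- apply/trivIsetP => i j _ _ ij; apply/seteqP; split => w //= [[/= Mi _] [/= Mj _]].
  by move: ij; rewrite -Mi -Mj eqxx.
- exact: bigcup_measurable.
Qed.

End random_sum.

(** * The mass equation *)

Section mass_equation.
Context d (H : measurableType d) (R : realType).
Variables (add : H -> H -> H) (zero : H) (L : H -> nat).
Hypothesis HM : counting_monoid add zero L.

(** The equation that characterizes compound Poisson laws with parameter [theta]
and summands of law [F]. *)
Definition mass_equation (theta : R) (F mu : probability H R) : Prop :=
  forall A, measurable A ->
    (\int[mu]_(x in A) mass L x =
     theta%:E * \int[F]_y (mass L y * mu [set x | A (add y x)]))%E.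

Lemma measurable_translate_measure (mu : probability H R) A : measurable A ->
  measurable_fun setT (fun y => mu [set x | A (add y x)]).
Proof.
move=> mA; have := measurable_fun_xsection mu
  (measurable_preimageT (measurable_add HM) mA).
congr (measurable_fun _ _); apply/funext => y /=; congr (mu _).
by apply/seteqP; split => x; rewrite /xsection/= ?inE//= => /set_mem.
Qed.

(** Two solutions of the mass equation are proportional on each level, by strong
induction on the level. *)
Lemma mass_equation_level theta F mu nu : mass_equation theta F mu ->
  mass_equation theta F nu ->
  forall n A, measurable A -> A `<=` [set x | L x = n] ->
  (nu [set x | L x = 0%N] * mu A = mu [set x | L x = 0%N] * nu A)%E.
Proof.
move=> eqmu eqnu; elim/ltn_ind => n IH A mA An.
have m0 := measurable_level HM 0.
have [n0|n_gt0] := posnP n.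
  have [A0|A0] := pselect (A zero).
    suff -> : A = [set x | L x = 0%N] by rewrite muleC.
    apply/seteqP; split=> x; first by move/An; rewrite n0.
    by move=> Lx; apply/(mass_eq0 HM mA Lx).
  suff -> : A = set0 by rewrite !measure0 !mule0.
  apply/seteqP; split=> x //= Ax; apply: A0.
  have Lx : L x = 0%N by rewrite (An _ Ax).
  exact/(mass_eq0 HM mA Lx).
have rec (m1 : probability H R) (c : \bar R) : mass_equation theta F m1 -> (0 <= c)%E ->
    (c * m1 A = (n%:R^-1 * theta)%:E *
      \int[F]_y (mass L y * (c * m1 [set x | A (add y x)])))%E.
  move=> eqm c0; have := eqm _ mA.
  rewrite (integral_mass_level _ mA An).
  set I := (\int[F]_y _)%E => nI.
  have -> : m1 A = ((n%:R^-1 * theta)%:E * I)%E.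
    by rewrite EFinM -muleA -nI muleA -EFinM mulVf ?mul1e// pnatr_eq0 -lt0n.
  under eq_integral do rewrite muleCA.
  rewrite ge0_integralZl//.
  - by rewrite muleCA.
  - apply: emeasurable_funM; first exact: measurable_mass HM.
    exact: measurable_translate_measure.
  - by move=> y _; rewrite mule_ge0 ?mass_ge0.
(* a summand [y] of positive mass leaves a set of level [n - L y < n] *)
rewrite (rec mu)// (rec nu)//; congr (_ * _)%E; apply: eq_integral => y _.
have [Ly0|Ly_gt0] := posnP (L y); first by rewrite /mass Ly0 !mul0e.
congr (_ * _)%E; apply: (IH (n - L y)%N).
- by rewrite ltn_subrL Ly_gt0.
- by apply: measurable_preimageT => //; exact: measurable_addl HM y.
- by move=> x /= /An /=; rewrite (mass_add HM) => <-; rewrite addKn.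
Qed.

Lemma mass_equation_unique theta F mu nu : mass_equation theta F mu ->
  mass_equation theta F nu -> nu [set x | L x = 0%N] != 0%E ->
  forall A, measurable A -> mu A = nu A.
Proof.
move=> eqmu eqnu nu0.
have key A : measurable A ->
    (nu [set x | L x = 0%N] * mu A = mu [set x | L x = 0%N] * nu A)%E.
  move=> mA; have m0 := measurable_level HM 0.
  rewrite (measure_levels HM mu mA) (measure_levels HM nu mA).
  rewrite -[X in (X * _ = _)%E]fineK ?fin_num_measure//.
  rewrite -[X in (_ = X * _)%E]fineK ?fin_num_measure//.
  rewrite -!nneseriesZl//; apply: eq_eseriesr => n _.
  rewrite !fineK ?fin_num_measure//.
  apply: (mass_equation_level eqmu eqnu (n := n)); last exact: subIsetr.
  by apply: measurableI => //; exact: measurable_level HM n.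
have := key _ measurableT; rewrite !probability_setT !mule1 => e0 A mA.
have a_fin : nu [set x | L x = 0%N] \is a fin_num.
  by rewrite fin_num_measure//; exact: measurable_level HM 0.
have := key A mA; rewrite -e0.
rewrite -(fineK a_fin) -(fineK (fin_num_measure mu _ mA)).
rewrite -(fineK (fin_num_measure nu _ mA)) -!EFinM => -[/mulfI] ->//.
by rewrite fine_eq0.
Qed.

Section compound_poisson.
Variables (theta : R) (F nu : probability H R).
Hypothesis theta_gt0 : 0 < theta.
Hypothesis nuE : forall A, measurable A ->
  nu A = (\sum_(k <oo) (poisson_pmf theta k)%:E * conv_power HM F k A)%E.

Lemma ge0_integral_compound_poisson f : measurable_fun setT f ->
  (forall x, 0 <= f x)%E ->
  (\int[nu]_x f x =
   \sum_(k <oo) (poisson_pmf theta k)%:E * \int[conv_power HM F k]_x f x)%E.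
Proof.
move=> mf f0.
pose m k : {measure set H -> \bar R} :=
  mscale (NngNum (poisson_pmf_ge0 theta k)) (conv_power HM F k).
transitivity (\int[mseries m 0]_x f x)%E.
  by apply: eq_measure_integral => A mA _; exact: nuE.
rewrite ge0_integral_measure_series//; apply: eq_eseriesr => k _.
by rewrite ge0_integral_mscale.
Qed.

(** The identity between Poisson weights behind the compound Poisson case of the
mass equation. *)
Lemma poisson_pmfS k :
  poisson_pmf theta k.+1 * k.+1%:R = theta * poisson_pmf theta k.
Proof.
rewrite /poisson_pmf theta_gt0 factS natrM exprS invfM.
have k0 : k.+1%:R != 0 :> R by rewrite pnatr_eq0.
by field; rewrite addrC natr1 k0 pnatr_eq0 -lt0n fact_gt0.
Qed.

Lemma compound_poisson_mass_equation : mass_equation theta F nu.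
Proof.
move=> A mA.
have m1A : measurable_fun setT (fun x : H => (\1_A x)%:E : \bar R).
  exact/measurable_EFinP.
have m1A0 x : (0 <= (\1_A x)%:E :> \bar R)%E by rewrite lee_fin.
have mT y : measurable [set x | A (add y x)].
  by apply: measurable_preimageT => //; exact: measurable_addl HM y.
rewrite integral_mkcond epatch_indic ge0_integral_compound_poisson/=; first last.
- by move=> x; rewrite mule_ge0 ?mass_ge0.
- by apply: emeasurable_funM => //; exact: measurable_mass HM.
rewrite nneseries_recl//; last first.
  move=> k _; rewrite mule_ge0 ?lee_fin ?poisson_pmf_ge0//.
  by apply: integral_ge0 => x _; rewrite mule_ge0 ?mass_ge0.
rewrite integral_dirac//; last first.
  by apply: emeasurable_funM => //; exact: measurable_mass HM.
(* the empty sum has no mass, so the series may start at 1 *)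
rewrite {1}/mass (mass_zero HM) mul0e !mule0 add0e -nneseries_addn; last first.
  move=> k; rewrite mule_ge0 ?lee_fin ?poisson_pmf_ge0//.
  by apply: integral_ge0 => x _; rewrite mule_ge0 ?mass_ge0.
under eq_integral do rewrite nuE//.
transitivity (theta%:E * \int[F]_y \sum_(k <oo)
    (mass L y * ((poisson_pmf theta k)%:E * conv_power HM F k [set x | A (add y x)])))%E.
  rewrite integral_nneseries//; first last.
  - by move=> k y; rewrite !mule_ge0 ?mass_ge0// lee_fin poisson_pmf_ge0.
  - move=> k; apply: emeasurable_funM; first exact: measurable_mass HM.
    by apply: measurable_funeM; exact: measurable_translate_measure.
  rewrite -nneseriesZl; last first.
    move=> k _; apply: integral_ge0 => y _.
    by rewrite !mule_ge0 ?mass_ge0// lee_fin poisson_pmf_ge0.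
  apply: eq_eseriesr => k _; rewrite addn1 integral_conv_power_mass//.
  rewrite muleA -EFinM poisson_pmfS EFinM -muleA; congr (_ * _)%E.
  rewrite -ge0_integralZl//; first last.
  - by rewrite lee_fin poisson_pmf_ge0.
  - by move=> y _; rewrite mule_ge0 ?mass_ge0//; exact: integral_ge0.
  - apply: emeasurable_funM; first exact: measurable_mass HM.
    apply: (@measurable_fun_fubini_tonelli_F _ _ _ _ _ _
      (fun p => (\1_A (add p.1 p.2))%:E)) => [|p]; last by rewrite lee_fin.
    exact: measurableT_comp m1A (measurable_add HM).
  apply: eq_integral => y _; rewrite muleCA; congr (_ * (_ * _))%E.
  by rewrite -[in RHS](setIT [set x | A (add y x)]) -integral_indic.
congr (_ * _)%E; apply: eq_integral => y _.
by rewrite /mass nneseriesZl// => k _; rewrite mule_ge0// lee_fin poisson_pmf_ge0.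
Qed.

(** The empty sum has positive probability. *)
Lemma compound_poisson_level0 : nu [set x | L x = 0%N] != 0%E.
Proof.
rewrite nuE; last exact: measurable_level HM 0.
rewrite gt_eqF// nneseries_recl//; last first.
  by move=> k _; rewrite mule_ge0 ?lee_fin ?poisson_pmf_ge0.
rewrite (@lt_le_trans _ _ ((poisson_pmf theta 0)%:E * 1)%E)//.
  by rewrite mule1 lte_fin /poisson_pmf theta_gt0 expr0 fact0 invr1 !mul1r expR_gt0.
rewrite /= diracE mem_set ?leeDl//; last exact: mass_zero HM.
by apply: nneseries_ge0 => k _ _; rewrite mule_ge0 ?lee_fin ?poisson_pmf_ge0.
Qed.

End compound_poisson.
End mass_equation.

(** * Joint measurability of counts and translations *)

Section counts.
Context (R : realType) (J : nat).
Implicit Types B : set (flow_space R J).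

Lemma measurable_pm_count B (i : nat) : measurable B ->
  measurable [set xi : point_measures R J | xi B = i%:R%:E].
Proof. by move=> mB; apply: sub_sigma_algebra; exists B, i. Qed.

Lemma measurable_fun_nat_valued d (T : measurableType d) (f : T -> \bar R) :
  (forall w, exists n : nat, f w = n%:R%:E) ->
  (forall n : nat, measurable [set w | f w = n%:R%:E]) -> measurable_fun setT f.
Proof.
move=> fnat mf _ A mA; rewrite setTI (_ : _ @^-1` _ =
    \bigcup_(n in [set n : nat | A n%:R%:E]) [set w | f w = n%:R%:E]).
  by apply: bigcup_measurable => n _; exact: mf.
apply/seteqP; split => [w /= Aw|w [n /= An ->]//].
by have [n fn] := fnat w; exists n; rewrite //= -fn.
Qed.

Lemma measurable_pm_eval B (r : R) : measurable B -> (forall x, B x -> `|x.1| <= r) ->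
  measurable_fun setT (fun xi : point_measures R J => xi B).
Proof.
move=> mB rB; apply: measurable_fun_nat_valued => [xi|n]; first exact: (pm_nat xi mB rB).
exact: measurable_pm_count.
Qed.

Lemma measurable_time_band (r : R) : measurable [set x : flow_space R J | `|x.1| <= r].
Proof.
have -> : [set x : flow_space R J | `|x.1| <= r] = fst @^-1` [set u : R | `|u| <= r] by [].
apply: measurable_preimageT; first exact: measurable_fst.
rewrite (_ : [set u | _] = `[- r, r]%classic); first exact: measurable_itv.
by apply/seteqP; split => u /=; rewrite in_itv/= ler_norml.
Qed.

Lemma measurable_translate2 :
  measurable_fun setT (fun x : measurableTypeR R * flow_space R J =>
    translate (x.1 : R) x.2).
Proof.
apply/measurable_fun_pairP; split.
  apply: measurable_funD; last exact: measurable_fst.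
  exact: measurableT_comp measurable_fst measurable_snd.
exact: measurableT_comp measurable_snd measurable_snd.
Qed.

(** The number of points that a translate of a point measure puts in a bounded set
is jointly measurable in the point measure and the translation.  For
translations bounded by [n], all the points that matter lie in a fixed bounded
band, on which a point measure is a kernel with finite values. *)
Lemma measurable_translate_count (r : R) B (i : nat) : measurable B ->
  (forall x, B x -> `|x.1| <= r) ->
  measurable [set p : point_measures R J * measurableTypeR R |
    p.1 (translate (p.2 : R) @^-1` B) = i%:R%:E].
Proof.
move=> mB rB.
rewrite [X in measurable X](_ : _ = \bigcup_n
  ([set p : point_measures R J * measurableTypeR R | `|p.2 : R| <= n%:R] `&`
  [set p : point_measures R J * measurableTypeR R |
    p.1 (translate (p.2 : R) @^-1` B `&` [set x | `|x.1| <= r + n%:R]) = i%:R%:E]));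
  last first.
  apply/seteqP; split => [p /= pB|p [n _ /= [pn]]].
    have /archi_boundP pn : 0 <= `|p.2 : R| by [].
    exists (Num.bound `|p.2 : R|) => //=; split; first exact: ltW.
    rewrite -pB; congr (p.1 _); apply: setIidl => x /= /rB /= xr.
    rewrite -[x.1](addrK (p.2 : R)) (le_trans (ler_normB _ _))// lerD//.
    exact: ltW.
  move=> <-; congr (p.1 _); apply/esym/setIidl => x /= /rB /= xr.
  by rewrite -[x.1](addrK (p.2 : R)) (le_trans (ler_normB _ _))// lerD.
apply: bigcup_measurable => n _; apply: measurableI.
  apply: (@measurable_preimageT _ _ _ _ snd [set u : R | `|u| <= n%:R]).
    exact: measurable_snd.
  rewrite (_ : [set u | _] = `[- n%:R, n%:R]%classic); first exact: measurable_itv.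
  by apply/seteqP; split => u /=; rewrite in_itv/= ler_norml.
set K := [set x : flow_space R J | `|x.1| <= r + n%:R].
have mK : measurable K by exact: measurable_time_band.
pose k0 (p : point_measures R J * measurableTypeR R) :
  {measure set (flow_space R J) -> \bar R} := mrestr p.1 mK.
have mk0 U : measurable U -> measurable_fun setT (k0 ^~ U).
  move=> mU.
  apply: (measurableT_comp (f := fun xi : point_measures R J => xi (U `&` K)));
    last exact: measurable_fst.
  by apply: (@measurable_pm_eval _ (r + n%:R)); [exact: measurableI|move=> x []].
pose k : kernel (point_measures R J * measurableTypeR R)%type (flow_space R J) R :=
  HB.pack k0 (isKernel.Build _ _ _ _ _ k0 mk0).
have mTB : measurable [set x : (point_measures R J * measurableTypeR R) * flow_space R J |
    B (translate (x.1.2 : R) x.2)].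
  apply: (@measurable_preimageT _ _ _ _
    (fun x : (point_measures R J * measurableTypeR R) * flow_space R J =>
      translate (x.1.2 : R) x.2)) => //.
  exact: (measurableT_comp measurable_translate2 (measurable_fun_pair
    (measurableT_comp measurable_snd measurable_fst) measurable_snd)).
have kbound p : exists M : R, forall X, measurable X ->
    (mrestr (k p) measurableT X < M%:E)%E.
  have [m Em] : exists m : nat, p.1 K = m%:R%:E.
    by apply: (pm_nat p.1 mK (r := r + n%:R)).
  exists (m%:R + 1) => X mX.
  rewrite (@le_lt_trans _ _ m%:R%:E)//; last by rewrite lte_fin ltrDl.
  rewrite /mrestr/= /k0 /= /mrestr -Em le_measure ?inE//.
  by apply: measurableI => //; apply: measurableI.
have [_ mphi] := measurable_prod_subset_xsection_kernel kbound mTB.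
rewrite [X in measurable X](_ : _ = (fun p => mrestr (k p) measurableT
  (xsection [set x : (point_measures R J * measurableTypeR R) * flow_space R J |
    B (translate (x.1.2 : R) x.2)] p)) @^-1` [set i%:R%:E]).
  by apply: measurable_preimageT.
apply/seteqP; split => p /=; rewrite /mrestr /= /k0 /= /mrestr setIT /xsection /=;
  under eq_set do rewrite inE/=; exact.
Qed.

End counts.

(** * The monoid of point measures on a window *)

Section window_monoid.
Context (R : realType) (J : nat) (C : {set link J}) (t : R).
Implicit Types (B : set (flow_space R J)) (x y : window_measures C t).

Lemma wm_eval_window x B : measurable B -> x B = x (B `&` window C t).
Proof.
move=> mB; have mW := measurable_window C t.
have x0 : x (B `\` window C t) = 0%E.
  apply/eqP; rewrite -measure_le0 -(wm_support x) le_measure ?inE//.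
  - exact: measurableD.
  - exact: measurableC.
transitivity (x (B `\` window C t) + x (B `&` window C t))%E.
  exact: measureDI.
by rewrite x0 add0e.
Qed.

Lemma measurable_wm_count B (i : nat) : measurable B ->
  measurable [set x : window_measures C t | x B = i%:R%:E].
Proof.
move=> mB; apply: sub_sigma_algebra; exists (B `&` window C t), i; split=> //.
- by apply: measurableI => //; exact: measurable_window.
- by apply/seteqP; split => x /=; rewrite -wm_eval_window.
Qed.

Lemma measurable_fun_wm d (T : measurableType d) (f : T -> window_measures C t) :
  (forall B (i : nat), measurable B -> B `<=` window C t ->
    measurable [set w | f w B = i%:R%:E]) ->
  measurable_fun setT f.
Proof.
move=> mf.
refine (@measurability _ _ T (window_measures C t) setT f
  (@window_count_events R J C t) _ _) => //.
by move=> _ [_ [B [i [mB BW ->]]] <-]; rewrite setTI; exact: mf.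
Qed.

(** Measurable sets of measures depend only on the values on measurable sets. *)
Lemma wm_indistinguishable x y (A : set (window_measures C t)) : measurable A ->
  (forall B, measurable B -> x B = y B) -> A x <-> A y.
Proof.
move=> mA xy; pose S := [set A : set (window_measures C t) | A x <-> A y].
suff : S A by [].
move: mA; rewrite /measurable/=.
apply: smallest_sub.
- split.
  + by [].
  + move=> D SD; rewrite /S/= in SD *.
    by split => -[_ DN]; split=> // ?; apply: DN; tauto.
  + move=> F SF; split=> -[n _ Fn]; exists n => //; have [h1 h2] := SF n.
      exact: h1.
    exact: h2.
- by move=> _ [B [i [mB _ ->]]]; rewrite /S/= xy.
Qed.

(** The number of points in the window. *)
Definition window_count x : nat := Num.truncn (fine (x (window C t))).

Lemma window_countE x : x (window C t) = (window_count x)%:R%:E.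
Proof.
by have [n En] := wm_nat x (measurable_window C t); rewrite /window_count En/= natrK.
Qed.

Lemma add_window_nat x y B : measurable B ->
  exists n : nat, measure_add x y B = n%:R%:E.
Proof.
move=> mB; have [m Em] := wm_nat x mB; have [n En] := wm_nat y mB.
by exists (m + n)%N; rewrite measure_addE Em En natrD.
Qed.

Lemma add_window_support x y : measure_add x y (~` window C t) = 0%E.
Proof. by rewrite measure_addE !wm_support adde0. Qed.

(** The sum of two measures on the window, and the measure without points. *)
Definition add_window x y : window_measures C t :=
  WindowMeasure (add_window_nat x y) (add_window_support x y).

Lemma add_windowE x y B : add_window x y B = (x B + y B)%E.
Proof. exact: measure_addE. Qed.

Definition zero_window : window_measures C t :=
  WindowMeasure (@mzero_window_nat R J) (@mzero_window_support R J C t).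

Lemma wm_ext x y : (forall B, x B = y B) -> x = y.
Proof.
case: x y => [m1 n1 s1] [m2 n2 s2] /= m12.
have e : m1 = m2 by apply: eq_measure; apply/funext.
by subst m2; congr WindowMeasure; exact: Prop_irrelevance.
Qed.

Lemma counting_monoid_window : counting_monoid add_window zero_window window_count.
Proof.
split.
- apply: measurable_fun_wm => B i mB _.
  rewrite [X in measurable X](_ : _ = \bigcup_(k < i.+1)
      ([set x : window_measures C t | x B = k%:R%:E] `*`
       [set y : window_measures C t | y B = (i - k)%:R%:E])).
    by apply: bigcup_measurable => k _; apply: measurableX; exact: measurable_wm_count.
  apply/seteqP; split => [[x y]|[x y] [k /= ki [xk yk]]] /=; rewrite add_windowE.
    have [m Em] := wm_nat x mB; have [n En] := wm_nat y mB.
    rewrite Em En -EFinD -natrD => -[/eqP]; rewrite eqr_nat => /eqP mn.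
    exists m => /=; first by rewrite -mn ltnS leq_addr.
    by rewrite -mn addKn.
  by rewrite xk yk -EFinD -natrD subnKC.
- move=> n; rewrite [X in measurable X](_ : _ =
      [set x : window_measures C t | x (window C t) = n%:R%:E]).
    by apply: measurable_wm_count; exact: measurable_window.
  apply/seteqP; split => x /=; rewrite window_countE; first by move=> ->.
  by case => /eqP; rewrite eqr_nat => /eqP.
- by move=> x y z; apply: wm_ext => B; rewrite !add_windowE addeA.
- by move=> x y; apply: wm_ext => B; rewrite !add_windowE addeC.
- by move=> x; apply: wm_ext => B; rewrite add_windowE [X in (X + _)%E]/= /mzero add0e.
- move=> x y; rewrite {1}/window_count add_windowE !window_countE.
  by rewrite -EFinD -natrD natrK.
- by rewrite -[RHS](@natrK R 0).
- move=> A mA x x0; apply: wm_indistinguishable => // B mB.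
  rewrite wm_eval_window// [in RHS]/zero_window/= /mzero.
  apply/eqP; rewrite -measure_le0 (@le_trans _ _ (x (window C t)))//.
    by rewrite le_measure ?inE//; [apply: measurableI => //|]; exact: measurable_window.
  by rewrite window_countE x0.
Qed.

End window_monoid.

Section sum_window.
Context (R : realType) (J : nat) (C : {set link J}) (t : R).

Lemma sum_window_partial_sum d (T : measurableType d)
    (X : nat -> T -> window_measures C t) n w :
  sum_window (fun i => X i w) n = partial_sum (@add_window R J C t) (zero_window C t) X n w.
Proof.
elim: n X => [|n IH] X /=; first by apply: wm_ext => B; rewrite /= /msum big_ord0.
by rewrite -IH; apply: wm_ext => B; rewrite add_windowE /= /msum big_ord_recl.
Qed.

End sum_window.

(** * The Palm formula on a window and stationarity *)

Section shifted_window.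
Context (R : realType) (J : nat) (C : {set link J}) (t : R).

(** The restriction to the window of a point measure moved by [s] in time. *)
Definition shifted_window (s : R) (z : point_measures R J) : window_measures C t :=
  restrict_window C t (translate_pm s z).

Lemma shifted_windowE s z B :
  shifted_window s z B = z (translate s @^-1` (B `&` window C t)).
Proof. by []. Qed.

Lemma measurable_shifted_window : measurable_fun setT
  (fun p : point_measures R J * measurableTypeR R => shifted_window p.2 p.1).
Proof.
apply: measurable_fun_wm => B i mB _.
apply: (@measurable_translate_count _ _ t (B `&` window C t)).
  by apply: measurableI => //; exact: measurable_window.
by move=> x [_]; exact: window_bounded.
Qed.

Lemma measurable_shifted_window1 s : measurable_fun setT (shifted_window s).
Proof. exact: (measurable_fun_pair1 (s : measurableTypeR R) measurable_shifted_window). Qed.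

Lemma measurable_shifted_process d (T : measurableType d)
  (Z : T -> point_measures R J) (mZ : measurable_fun setT Z) s :
  measurable_fun setT (fun w => shifted_window s (Z w)).
Proof. exact: measurableT_comp (measurable_shifted_window1 s) mZ. Qed.

Lemma shifted_window_translate s u z :
  shifted_window u (translate_pm s z) = shifted_window (s + u) z.
Proof.
apply: wm_ext => B; rewrite !shifted_windowE /=.
rewrite /pushforward/=; congr (z _); apply/seteqP.
by split => x; rewrite /translate/= addrA.
Qed.

Lemma shifted_window_add s z z' :
  shifted_window s (add_pm z z') =
  add_window (shifted_window s z) (shifted_window s z').
Proof. by apply: wm_ext => B; rewrite add_windowE !shifted_windowE -measure_addE. Qed.

Lemma shifted_window0 z : shifted_window 0 z = restrict_window C t z.
Proof.
apply: wm_ext => B; rewrite shifted_windowE /= /mrestr; congr (z _).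
by apply/seteqP; split => x; rewrite /translate/= addr0 -surjective_pairing.
Qed.

End shifted_window.
Arguments measurable_shifted_process {R J} C t {d T Z} mZ s.

Section palm.
Context (R : realType) (J : nat) (net : jackson_network R J).
Context d (Omega : measurableType d) (P : probability Omega R).
Variables (Xi : Omega -> point_measures R J) (mXi : measurable_fun setT Xi).
Variable Q : R.-pker (flow_space R J) ~> point_measures R J.
Hypothesis palm : palm_distribution P net Xi Q.
Variables (C : {set link J}) (t : R).

Lemma rho_ge0 l : 0 <= rho net l.
Proof.
case: l => -[j|] [k|]; rewrite /rho/=;
  by rewrite ?mulr_ge0 ?nu_ge0 ?lam_ge0 ?mu_ge0// ltW ?alpha_gt0.
Qed.

Lemma measurable_palm_shift l A : measurable A ->
  measurable_fun (setT : set (measurableTypeR R))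
    (fun s => Q (0%R, l) [set z | A (shifted_window C t s z)]).
Proof.
move=> mA; rewrite (_ : (fun s => _) =
    (fun s => Q (s, l) (shifted_window C t 0 @^-1` A))).
  have mU : measurable (shifted_window C t 0 @^-1` A).
    by apply: measurable_preimageT => //; exact: measurable_shifted_window1.
  have mp : measurable_fun setT (fun s : measurableTypeR R => (s, l) : flow_space R J).
    exact: measurable_fun_pair.
  exact: (measurableT_comp (measurable_kernel Q _ mU) mp).
apply/funext => s; rewrite palm.2; last first.
  by apply: measurable_preimageT => //; exact: measurable_shifted_window1.
by congr (Q _ _); apply/seteqP; split => z /=; rewrite shifted_window_translate addr0.
Qed.

(** The Palm formula for the number of points in the window.  The right-hand side
does not involve the shift [u], because the Palm kernel is compatible with
shifts and Lebesgue measure is invariant. *)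
Lemma palm_window u A : measurable A ->
  (\int[law P (measurable_shifted_process C t mXi u)]_(x in A)
     mass (@window_count R J C t) x =
   \sum_(l in C) \int[lebesgue_measure]_(s in `[0%R, t])
      (Q (0%R, l) [set z | A (shifted_window C t s z)] * (rho net l)%:E))%E.
Proof.
move=> mA; have mmass := @measurable_mass _ _ R _ _ _ (@counting_monoid_window R J C t).
rewrite ge0_integral_pushforward//; last 2 first.
- exact: measurable_funTS.
- by move=> x _; rewrite mass_ge0.
have mW := measurable_window C t.
transitivity (\int[P]_(w in Xi @^-1` (shifted_window C t u @^-1` A))
    Xi w (translate u @^-1` window C t))%E.
  apply: eq_integral => w _ /=.
  by rewrite /mass -window_countE shifted_windowE setIid.
rewrite palm.1; [|by apply: measurable_preimageT => //; exact: measurable_shifted_window1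
  |by apply: measurable_preimageT => //; exact: measurable_translate].
rewrite [RHS]big_mkcond/=; apply: eq_bigr => l _.
rewrite (_ : [set s | _] = [set s | [set s | window C t (s, l)] (s + u)]); last by [].
transitivity (\int[lebesgue_measure]_(s in [set s | [set s | window C t (s, l)] (s + u)%R])
   (Q (0%R, l) [set z | A (shifted_window C t (s + u)%R z)] * (rho net l)%:E))%E.
  apply: eq_integral => s _; congr (_ * _)%E; rewrite palm.2; last first.
    by apply: measurable_preimageT => //; exact: measurable_shifted_window1.
  by congr (Q _ _); apply/seteqP; split => z /=; rewrite shifted_window_translate.
have WE : [set s | window C t (s, l)] = if l \in C then `[0%R, t]%classic else set0.
  case: ifPn => lC; apply/seteqP; split => s; rewrite /window/= ?in_itv/=.
  - by case.
  - by split.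
  - by case=> _; rewrite (negPf lC).
  - by [].
rewrite WE (@integral_shift _ u _ (fun s =>
  Q (0%R, l) [set z | A (shifted_window C t s z)] * (rho net l)%:E)%E).
- by case: ifPn => // _; rewrite integral_set0.
- by case: ifPn => // _; exact: measurable_itv.
- by apply: emeasurable_funM => //; exact: measurable_palm_shift.
- by move=> s; rewrite mule_ge0// lee_fin rho_ge0.
Qed.

(** The restriction of the flow to a window is stationary. *)
Lemma stationary_window u A : measurable A ->
  law P (measurable_shifted_process C t mXi u) A =
  law P (measurable_shifted_process C t mXi 0) A.
Proof.
move=> mA; apply: (eq_mass_integral (@counting_monoid_window R J C t)) => // B mB.
by rewrite !palm_window.
Qed.

End palm.

(** * The extra customer *)

Section extra_customer.
Context (R : realType) (J : nat) (net : jackson_network R J).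
Context d (Omega : measurableType d) (P : probability Omega R).
Variables (Xi : Omega -> point_measures R J) (mXi : measurable_fun setT Xi).
Variable Q : R.-pker (flow_space R J) ~> point_measures R J.
Hypothesis palm : palm_distribution P net Xi Q.

(** The Palm probability of an event on the window: the extra customer is
independent of the flow, whose restriction is stationary. *)
Lemma palm_extra_customer (C : {set link J}) (t : R) l z s A :
  extra_customer P Xi Q l z -> measurable A ->
  Q (0%R, l) [set y | A (shifted_window C t s y)] =
  (\int[P]_w law P (measurable_shifted_process C t mXi 0)
     [set x | A (add_window (shifted_window C t s (z w)) x)])%E.
Proof.
move=> [mz indep Qz] mA.
have mS := measurable_shifted_window1 (C := C) (t := t) s.
rewrite -Qz; last exact: (measurable_preimageT mS mA).
have mD := measurable_preimageT (measurable_add (@counting_monoid_window R J C t)) mA.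
transitivity (P [set w |
  A (add_window (shifted_window C t s (z w)) (shifted_window C t s (Xi w)))]).
  by congr (P _); apply/seteqP; split => w /=; rewrite shifted_window_add.
have ind2 : independent2 P (fun w => shifted_window C t s (z w))
    (fun w => shifted_window C t s (Xi w)).
  move=> B D mB mD'.
  exact: (indep _ _ (measurable_preimageT mS mB) (measurable_preimageT mS mD')).
rewrite (independent2_integral (measurable_shifted_process C t mz s)
  (measurable_shifted_process C t mXi s) ind2 mD).
apply: eq_integral => w _; apply: (stationary_window mXi palm).
apply: (measurable_preimageT _ mA).
exact: (measurable_addl (@counting_monoid_window R J C t)).
Qed.

(** The points of [z] seen through the window [C, t] after a shift by [s] are those in
the time interval [[-s, t - s]] and on the links in [C]; a smaller range has
fewer points. *)
Lemma shifted_window_count_eq0 (C C' : {set link J}) (t t' s s' : R)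
    (z : point_measures R J) :
  C' \subset C -> s' <= s -> t' - s' <= t - s ->
  window_count (shifted_window C t s z) = 0%N ->
  window_count (shifted_window C' t' s' z) = 0%N.
Proof.
move=> CC ss ts /(congr1 (fun n => n%:R%:E : \bar R)).
rewrite -window_countE shifted_windowE setIid => z0.
have := @window_countE R J C' t' (shifted_window C' t' s' z).
rewrite shifted_windowE setIid => z1.
have mW (D : {set link J}) (a b : R) : measurable (translate b @^-1` window D a).
  by apply: measurable_preimageT; [exact: measurable_translate|exact: measurable_window].
have : (z (translate s' @^-1` window C' t') <= 0)%E.
  rewrite -[leRHS]z0 le_measure ?inE//.
  move=> x; rewrite /translate /window/= => -[/andP[x0 x1] xC].
  split; last exact: (fintype.subsetP CC).
  apply/andP; split; lra.
by rewrite z1 lee_fin lern0 => /eqP.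
Qed.

(** The extra customer has almost surely a point in the window.  The proof looks at
the single link [l] and at a duration [delta] so short that the flow is empty
there with positive probability. *)
Lemma extra_customer_window_gt0 (C : {set link J}) t l z s : l \in C -> 0 < rho net l ->
  extra_customer P Xi Q l z -> 0 < s < t ->
  P [set w | window_count (shifted_window C t s (z w)) = 0%N] = 0%E.
Proof.
move=> lC rl ez /andP[s0 st].
have [mz _ _] := ez.
have [delta [d0 ds dts rd]] : exists delta : R,
    [/\ 0 < delta, delta <= s, delta <= t - s & rho net l * delta < 1].
  (* [delta <= s] and [delta <= t - s] ensure that, for [0 <= u <= delta], the
     interval [[-u, delta - u]] is contained in [[-s, t - s]] *)
  exists (Num.min s (Num.min (t - s) ((rho net l)^-1 / 2))).
  have h0 : 0 < (rho net l)^-1 by rewrite invr_gt0.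
  split.
  - by rewrite !lt_min s0 subr_gt0 st/= divr_gt0.
  - by rewrite ge_min lexx.
  - by rewrite !ge_min lexx orbT.
  - apply: (@le_lt_trans _ _ (rho net l * ((rho net l)^-1 / 2))).
      by rewrite ler_pM2l// !ge_min lexx !orbT.
    by rewrite mulrA mulfV ?gt_eqF// mul1r; lra.
pose D : {set link J} := [set l]%SET.
pose mu1 := law P (measurable_shifted_process D delta mXi 0).
have HM := @counting_monoid_window R J D delta.
(* the mean number of points is less than 1, so there may be none *)
have mass1 : (\int[mu1]_x mass (@window_count R J D delta) x = (rho net l * delta)%:E)%E.
  rewrite /mu1 (palm_window mXi palm)// big_set1.
  transitivity (\int[lebesgue_measure]_(s in `[0%R, delta])
      (cst (rho net l)%:E s : \bar R))%E.
    apply: eq_integral => u _.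
    by rewrite (_ : [set _ | _] = setT)// prob_kernel mul1e.
  have mI : measurable (`[0%R, delta]%classic : set (measurableTypeR R)).
    exact: measurable_itv.
  rewrite (integral_cst (@lebesgue_measure R) mI).
  rewrite EFinM; congr (_ * _)%E.
  transitivity (lebesgue_measure (`[0%R, delta]%classic : set R)); first by [].
  by rewrite lebesgue_measure_itv/= lte_fin d0 -EFinB subr0.
have mL0 := measurable_level HM 0.
have mu10 : mu1 [set x | window_count x = 0%N] != 0%E.
  apply/eqP => mu0.
  suff : (1 <= (rho net l * delta)%:E :> \bar R)%E by rewrite lee_fin leNgt rd.
  rewrite -mass1.
  have <- : (\int[mu1]_(x in ~` [set x | window_count x = 0%N]) (cst 1 x : \bar R) = 1)%E.
    transitivity (1 * mu1 (~` [set x | window_count x = 0%N]))%E.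
      by apply: integral_cst; exact: measurableC.
    by rewrite mul1e (probability_setC _ mL0) mu0 sube0.
  apply: (@le_trans _ _ (\int[mu1]_(x in ~` [set x | window_count x = 0%N])
      mass (@window_count R J D delta) x)%E).
    apply: ge0_le_integral => //.
    - exact: measurableC.
    - by apply: measurable_funTS; exact: (@measurable_mass _ _ R _ _ _ HM).
    - by move=> x /= /eqP x0; rewrite /mass lee_fin ler1n lt0n.
  apply: ge0_subset_integral => //.
  - exact: measurableC.
  - exact: (@measurable_mass _ _ R _ _ _ HM).
  - by move=> x _; exact: mass_ge0.
pose A := [set x : window_measures D delta | window_count x = 0%N].
(* the Palm formula for the event that there is no point *)
have qz : (\int[lebesgue_measure]_(u in `[0%R, delta])
    (Q (0%R, l) [set y | A (shifted_window D delta u y)] * (rho net l)%:E) = 0)%E.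
  have := palm_window mXi palm (C := D) (t := delta) 0 mL0.
  rewrite big_set1 => <-.
  by rewrite (integral_mass_level _ mL0 (n := 0%N)) ?mul0e.
(* otherwise the integrand would be positive on the whole of [[0, delta]] *)
have [u /andP[u0 ud] qu] : exists2 u, 0 <= u <= delta &
    Q (0%R, l) [set y | A (shifted_window D delta u y)] = 0%E.
  apply: contrapT => no.
  have mI : measurable (`[0%R, delta]%classic : set (measurableTypeR R)).
    exact: measurable_itv.
  have mf : measurable_fun (`[0%R, delta]%classic : set (measurableTypeR R)) (fun u =>
      Q (0%R, l) [set y | A (shifted_window D delta u y)] * (rho net l)%:E)%E.
    apply: measurable_funTS; apply: emeasurable_funM => //.
    exact: (measurable_palm_shift palm).
  have : (\int[lebesgue_measure]_(u in `[0%R, delta])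
    `|Q (0%R, l) [set y | A (shifted_window D delta u y)] * (rho net l)%:E| = 0)%E.
    rewrite -[RHS]qz; apply: eq_integral => u _.
    by rewrite gee0_abs// mule_ge0// lee_fin ltW.
  move/(ae_eq_integral_abs _ mI mf) => [N [mN N0 sN]].
  suff : (lebesgue_measure `[0%R, delta]%classic <= 0%:E :> \bar R)%E.
    by rewrite lebesgue_measure_itv/= lte_fin d0 -EFinB subr0 lee_fin leNgt d0.
  apply: (@le_trans _ _ (lebesgue_measure N)); last by rewrite N0.
  rewrite le_measure ?inE// => u; rewrite /= in_itv/= => u0d.
  apply: sN => /= /(_ _) h; apply: no; exists u => //.
  move: h; rewrite in_itv/= u0d => /(_ isT) /eqP.
  by rewrite mule_eq0 => /orP[/eqP//|]; rewrite eqe gt_eqF.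
(* by independence, no point from the extra customer and none from the flow *)
have PA : P [set w | A (shifted_window D delta u (z w))] = 0%E.
  have mA := measurable_preimageT (measurable_shifted_process D delta mz u) mL0.
  move: qu; rewrite (palm_extra_customer _ ez)//.
  rewrite (_ : (\int[P]_w _)%E =
      (mu1 A * P ((fun w => shifted_window D delta u (z w)) @^-1` A))%E).
    by move=> /eqP; rewrite mule_eq0 (negPf mu10)/= => /eqP.
  rewrite -[X in P X]setIT -integral_indic// -ge0_integralZl//; last first.
    exact/measurable_EFinP.
  apply: eq_integral => w _; rewrite indicE.
  have [/set_mem Aw|Aw] := boolP (w \in _).
    rewrite mule1; congr (law _ _ _); apply/seteqP; split => x.
      by rewrite /A/= (mass_add HM) Aw.
    by rewrite /A/= (mass_add HM) Aw.
  rewrite mule0 (_ : [set x | _] = set0) ?measure0//.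
  apply/seteqP; split => x //; rewrite /A/= (mass_add HM) => /eqP.
  by rewrite addn_eq0 => /andP[/eqP Aw' _]; move: Aw; rewrite mem_set.
apply/eqP; rewrite -measure_le0 -PA le_measure ?inE//.
- exact: (measurable_preimageT (measurable_shifted_process C t mz s)
    (measurable_level (@counting_monoid_window R J C t) 0)).
- exact: (measurable_preimageT (measurable_shifted_process D delta mz u) mL0).
move=> w /=; apply: shifted_window_count_eq0 => //.
- by rewrite finset.sub1set.
- exact: le_trans ud _.
- lra.
Qed.

End extra_customer.

(** * The mass equation of the flow *)

Section intensity.
Context (R : realType) (J : nat) (net : jackson_network R J).
Context d (Omega : measurableType d) (P : probability Omega R).
Variables (Xi : Omega -> point_measures R J) (mXi : measurable_fun setT Xi).
Variable Q : R.-pker (flow_space R J) ~> point_measures R J.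
Hypothesis palm : palm_distribution P net Xi Q.
Variable xi : link J -> Omega -> point_measures R J.
Hypothesis mxi : forall l, measurable_fun setT (xi l).
Hypothesis extra : forall l, 0 < rho net l -> extra_customer P Xi Q l (xi l).
Variables (C : {set link J}) (t : R).

(** [Phi l (w, s)] is the restriction to the window of the extra process at
[(s, l)]; [leb] is Lebesgue measure on [[0, t]]. *)
Let Phi l (p : Omega * measurableTypeR R) := shifted_window C t p.2 (xi l p.1).

Let mPhi l : measurable_fun setT (Phi l).
Proof.
have mp : measurable_fun setT (fun p : Omega * measurableTypeR R => (xi l p.1, p.2)).
  by apply: measurable_fun_pair; [exact: measurableT_comp|exact: measurable_snd].
exact: (measurableT_comp (@measurable_shifted_window R J C t) mp).
Qed.

Let mI : measurable (`[0%R, t]%classic : set (measurableTypeR R)).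
Proof. exact: measurable_itv. Qed.

Let Ioo : (lebesgue_measure (`[0%R, t]%classic : set (measurableTypeR R)) < +oo)%E.
Proof. by rewrite lebesgue_measure_itv/=; case: ifP; rewrite ?ltry. Qed.

Let leb : {finite_measure set (measurableTypeR R) -> \bar R} := mfrestr mI Ioo.

Let integral_leb f : measurable_fun setT f -> (forall s, 0 <= f s)%E ->
  (\int[leb]_s f s = \int[lebesgue_measure]_(s in `[0%R, t]) f s)%E.
Proof. by move=> mf f0; exact: (ge0_integral_mrestr _ mI). Qed.

(** The image on the window of [P] times Lebesgue measure on [[0, t]] by the extra
process at [(s, l)], [s] in [[0, t]]. *)
Definition extra_intensity l : {measure set (window_measures C t) -> \bar R} :=
  image_measure (P \x leb)%E (mPhi l).

Section integrals.
Variables (l : link J) (h : window_measures C t -> \bar R).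
Hypotheses (mh : measurable_fun setT h) (h0 : forall x, (0 <= h x)%E).

Let mhPhi : measurable_fun setT (fun p => h (Phi l p)).
Proof. exact: measurableT_comp. Qed.

Lemma extra_intensity_integral1 :
  (\int[extra_intensity l]_x h x =
   \int[P]_w \int[lebesgue_measure]_(s in `[0%R, t]) h (shifted_window C t s (xi l w)))%E.
Proof.
transitivity (\int[(P \x leb)%E]_p h (Phi l p))%E.
  exact: ge0_integral_image_measure.
rewrite (fubini_tonelli1 _ mhPhi (fun p => h0 _)).
apply: eq_integral => w _.
exact: (integral_leb (measurable_fun_pair2 w mhPhi) (fun s => h0 _)).
Qed.

Lemma extra_intensity_integral2 :
  (\int[extra_intensity l]_x h x =
   \int[lebesgue_measure]_(s in `[0%R, t]) \int[P]_w h (shifted_window C t s (xi l w)))%E.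
Proof.
transitivity (\int[(P \x leb)%E]_p h (Phi l p))%E.
  exact: ge0_integral_image_measure.
rewrite (fubini_tonelli2 _ mhPhi (fun p => h0 _)).
apply: (integral_leb (f := fun s => \int[P]_w h (Phi l (w, s)))%E).
- exact: (measurable_fun_fubini_tonelli_G _ mhPhi (fun p => h0 _)).
- by move=> s; exact: integral_ge0.
Qed.

Lemma measurable_extra_intensity1 : measurable_fun setT (fun w =>
  \int[lebesgue_measure]_(s in `[0%R, t]) h (shifted_window C t s (xi l w)))%E.
Proof.
rewrite (_ : (fun _ => _) = fubini_F leb (fun p => h (Phi l p))).
  exact: (measurable_fun_fubini_tonelli_F _ mhPhi (fun p => h0 _)).
apply/funext => w; apply/esym.
exact: (integral_leb (measurable_fun_pair2 w mhPhi) (fun s => h0 _)).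
Qed.

Lemma measurable_extra_intensity2 : measurable_fun (setT : set (measurableTypeR R))
  (fun s => \int[P]_w h (shifted_window C t s (xi l w)))%E.
Proof. exact: (measurable_fun_fubini_tonelli_G _ mhPhi (fun p => h0 _)). Qed.

End integrals.

(** The intensity does not charge the measures without points; the end points
[s = 0] and [s = t] are negligible. *)
Lemma extra_intensity_level0 l : l \in C -> 0 < rho net l ->
  extra_intensity l [set x | window_count x = 0%N] = 0%E.
Proof.
move=> lC rl; pose E0 := [set x : window_measures C t | window_count x = 0%N].
have mE0 : measurable E0 by exact: (measurable_level (@counting_monoid_window R J C t) 0).
have m1 : measurable_fun setT (fun x => (\1_E0 x)%:E : \bar R) by apply/measurable_EFinP.
rewrite -[X in extra_intensity l X]setIT -integral_indic//.
rewrite extra_intensity_integral2//.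
rewrite integral_itv_bndoo; last first.
  by apply: measurable_funTS; exact: (measurable_extra_intensity2 l m1).
rewrite -[RHS](integral0 lebesgue_measure (`]0%R, t[%classic : set (measurableTypeR R))).
apply: eq_integral => s /set_mem /=; rewrite in_itv/= => s0t.
rewrite -(extra_customer_window_gt0 mXi palm lC rl (extra rl) s0t).
rewrite -[X in P X]setIT -integral_indic//.
exact: (measurable_preimageT (measurable_shifted_process C t (mxi l) s) mE0).
Qed.

(** The Palm formula for the flow, in terms of the intensities of the extra
processes. *)
Lemma flow_mass_identity A : measurable A ->
  (\int[law P (measurable_shifted_process C t mXi 0)]_(x in A)
     mass (@window_count R J C t) x =
   \sum_(l in C) (rho net l)%:E * \int[extra_intensity l]_y
     law P (measurable_shifted_process C t mXi 0) [set x | A (add_window y x)])%E.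
Proof.
move=> mA; rewrite (palm_window mXi palm)//; apply: eq_bigr => l lC.
have mg := measurable_translate_measure (@counting_monoid_window R J C t)
  (law P (measurable_shifted_process C t mXi 0)) mA.
have [rl|] := ltP 0 (rho net l); last first.
  move=> rl; have -> : rho net l = 0 by apply/eqP; rewrite eq_le rl rho_ge0.
  by rewrite mul0e; under eq_integral do rewrite mule0; rewrite integral0.
rewrite extra_intensity_integral2// muleC -ge0_integralZr//; first last.
- by rewrite lee_fin ltW.
- by move=> s _; exact: integral_ge0.
- by apply: measurable_funTS; exact: (measurable_extra_intensity2 l mg).
apply: eq_integral => s _; congr (_ * _)%E.
exact: (palm_extra_customer mXi palm _ (extra rl)).
Qed.

Section summand.
Variables (theta : R) (F : probability (window_measures C t) R).
Hypothesis theta_gt0 : 0 < theta.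
Hypothesis FE : forall A : set (window_measures C t), measurable A ->
  F A = (\int[P]_w \sum_(l in C) \int[lebesgue_measure]_(s in `[0%R, t])
        (\1_A (shifted_window C t s (xi l w)) /
           fine (translate_pm s (xi l w) (window C t)) *
         (rho net l / theta))%:E)%E.

(** On the level [n > 0], the law of the summands has weight [1 / n]. *)
Lemma summand_level n A : (0 < n)%N -> measurable A ->
  A `<=` [set x | window_count x = n] ->
  (F A = \sum_(l in C) (n%:R^-1 * (rho net l / theta))%:E * extra_intensity l A)%E.
Proof.
move=> n_gt0 mA An; rewrite FE//.
have m1 : measurable_fun setT (fun x => (\1_A x)%:E : \bar R) by apply/measurable_EFinP.
have c0 l : 0 <= n%:R^-1 * (rho net l / theta).
  by rewrite mulr_ge0 ?invr_ge0// divr_ge0 ?rho_ge0// ltW.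
transitivity (\int[P]_w \sum_(l <- enum C) (n%:R^-1 * (rho net l / theta))%:E *
    \int[lebesgue_measure]_(s in `[0%R, t]) (\1_A (shifted_window C t s (xi l w)))%:E)%E.
  apply: eq_integral => w _; rewrite big_enum/=; apply: eq_bigr => l _.
  rewrite -ge0_integralZl//.
  - apply: eq_integral => s _; rewrite -EFinM; congr EFin.
    rewrite mulrC mulrA; rewrite indicE; have [/set_mem/An Aw|_] := boolP (_ \in A).
      rewrite (_ : fine _ = n%:R); last first.
        rewrite -[in RHS]Aw -[RHS]/(fine (_%:R%:E : \bar R)) -window_countE.
        by rewrite shifted_windowE setIid.
      by rewrite !mulr1 mulrC.
    by rewrite !mulr0 mul0r.
  - apply: measurable_funTS.
    exact: (measurable_fun_pair2 w (measurableT_comp m1 (mPhi l))).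
  - by rewrite lee_fin; exact: c0.
rewrite ge0_integral_sum//; first last.
- move=> l w _; rewrite mule_ge0 ?lee_fin//.
  by apply: integral_ge0 => s _; rewrite lee_fin.
- by move=> l; apply: measurable_funeM; exact: (measurable_extra_intensity1 l m1).
rewrite big_enum/=; apply: eq_bigr => l _; rewrite ge0_integralZl//; first last.
- by rewrite lee_fin; exact: c0.
- by move=> w _; apply: integral_ge0 => s _; rewrite lee_fin.
- exact: (measurable_extra_intensity1 l m1).
rewrite -(extra_intensity_integral1 l m1)//.
by rewrite integral_indic// setIT.
Qed.

(** The intensity of the extra processes has density [theta * L] with respect to the
law of the summands; on the level 0 both sides vanish. *)
Lemma summand_mass_identity h : measurable_fun setT h -> (forall x, 0 <= h x)%E ->
  (\sum_(l in C) (rho net l)%:E * \int[extra_intensity l]_x h x =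
   theta%:E * \int[F]_x (mass (@window_count R J C t) x * h x))%E.
Proof.
move=> mh h0.
have [M [MA Mint]] := finite_combination_measure (enum C) extra_intensity (rho_ge0 net).
rewrite -(mass_density_integral (@counting_monoid_window R J C t) (M := M))//; first last.
- move=> n A mA An; rewrite MA// big_enum/=.
  have [n0|n_gt0] := posnP n.
    rewrite n0 mul0r mul0e big1// => l lC.
    have [rl|rl] := ltP 0 (rho net l); last first.
      have -> : rho net l = 0 by apply/eqP; rewrite eq_le rl rho_ge0.
      by rewrite mul0e.
    rewrite (_ : extra_intensity l A = 0%E) ?mule0//.
    apply/eqP; rewrite -measure_le0 -(extra_intensity_level0 lC rl) le_measure ?inE//.
      exact: (measurable_level (@counting_monoid_window R J C t) 0).
    by rewrite -n0.
  rewrite (summand_level n_gt0 mA An) ge0_sume_distrr; last first.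
    move=> l _; rewrite mule_ge0// lee_fin.
    by rewrite mulr_ge0 ?invr_ge0// divr_ge0 ?rho_ge0// ltW.
  apply: eq_bigr => l _; rewrite muleA -EFinM; congr (_%:E * _)%E.
  have nn : n%:R != 0 :> R by rewrite pnatr_eq0 -lt0n.
  by field; rewrite nn gt_eqF.
- exact: ltW.
by rewrite Mint// big_enum.
Qed.

(** The law of the flow on the window solves the mass equation. *)
Lemma flow_mass_equation : mass_equation (@add_window R J C t) (@window_count R J C t)
  theta F (law P (measurable_shifted_process C t mXi 0)).
Proof.
move=> A mA; rewrite flow_mass_identity// summand_mass_identity//.
exact: (measurable_translate_measure (@counting_monoid_window R J C t)).
Qed.

End summand.
End intensity.

(** * Compound Poisson representation of the flow *)

Theorem theorem2p3 (R : realType) (J : nat) (net : jackson_network R J)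
    (d : measure_display) (Omega : measurableType d) (P : probability Omega R)
    (N : R -> Omega -> queue_state J) (Xi : Omega -> point_measures R J)
    (flow : jackson_flow P net N Xi)
    (Q : R.-pker (flow_space R J) ~> point_measures R J)
    (palm : palm_distribution P net Xi Q)
    (xi : link J -> Omega -> point_measures R J)
    (extra : forall l, 0 < rho net l -> extra_customer P Xi Q l (xi l))
    (C : {set link J}) (rhoC : 0 < \sum_(l in C) rho net l)
    (t : R) (t_gt0 : 0 < t)
    (d' : measure_display) (Omega' : measurableType d')
    (P' : probability Omega' R)
    (eta : nat -> Omega' -> window_measures C t) (M : Omega' -> nat)
    (eta_iid : iid P' eta)
    (eta_ge1 : P' [set w | (1 <= eta 0%N w (window C t))%E] = 1%E)
    (eta_law : forall A : set (window_measures C t), measurable A ->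
      P' (eta 0%N @^-1` A) =
      (\int[P]_w \sum_(l in C) \int[lebesgue_measure]_(s in `[0%R, t])
        (\1_A (restrict_window C t (translate_pm s (xi l w))) /
           fine (translate_pm s (xi l w) (window C t)) *
         (rho net l / theta P net xi C t))%:E)%E)
    (M_measurable : measurable_fun setT M)
    (M_poisson : forall k, P' (M @^-1` [set k]) =
      (poisson_pmf (theta P net xi C t) k)%:E)
    (M_independent : independent_of_sequence P' M eta) :
  forall A : set (window_measures C t), measurable A ->
    P [set w | A (restrict_window C t (Xi w))] =
    P' [set w | A (sum_window (fun i => eta i.+1 w) (M w))].
Proof.
have mXi := flow_measurable_Xi flow.
have [meta eta_id eta_indep] := eta_iid.
set th := theta P net xi C t in eta_law M_poisson.
have th_ge0 : 0 <= th.
  apply: fine_ge0; apply: integral_ge0 => w _; apply: sume_ge0 => l _.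
  apply: integral_ge0 => s _; rewrite lee_fin mulr_ge0 ?rho_ge0// invr_ge0 fine_ge0.
(* with [theta = 0], hence [rho / theta = 0], the law of the
   summands would have total mass 0 *)
have th_gt0 : 0 < th.
  rewrite lt_neqAle th_ge0 andbT eq_sym; apply/eqP => th0.
  have := eta_law setT measurableT.
  rewrite preimage_setT probability_setT => one0.
  suff : 1%E = 0%E :> \bar R by move/eqP; rewrite eqe oner_eq0.
  rewrite one0; apply: integral0_eq => w _; apply: big1 => l _.
  by apply: integral0_eq => s _; rewrite th0 invr0 !mulr0.
(* where [rho] vanishes nothing is assumed on [xi], not even measurability, so it
   is replaced there by the measure without points *)
pose xi' l := if 0 < rho net l then xi l else fun=> (point : point_measures R J).
have mxi' l : measurable_fun setT (xi' l).
  by rewrite /xi'; case: ifPn => // /extra [].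
have extra' l : 0 < rho net l -> extra_customer P Xi Q l (xi' l).
  by move=> rl; rewrite /xi' rl; exact: extra.
pose F := law P' (meta 0%N).
have FE (A : set (window_measures C t)) : measurable A ->
    F A = (\int[P]_w \sum_(l in C) \int[lebesgue_measure]_(s in `[0%R, t])
        (\1_A (shifted_window C t s (xi' l w)) /
           fine (translate_pm s (xi' l w) (window C t)) *
         (rho net l / th))%:E)%E.
  move=> mA; rewrite [LHS](eta_law _ mA); apply: eq_integral => w _.
  apply: eq_bigr => l _; apply: eq_integral => s _.
  rewrite /xi'; case: ifPn => // rl.
  have -> : rho net l = 0 by apply/eqP; rewrite eq_le rho_ge0 leNgt rl.
  by rewrite mul0r !mulr0.
have mu_eq := flow_mass_equation mXi palm mxi' extra' th_gt0 FE.
have HM := @counting_monoid_window R J C t.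
have mM k : measurable (M @^-1` [set k]) by exact: measurable_preimageT.
have indep k n (B : nat -> set (window_measures C t)) : (forall i, measurable (B i)) ->
    P' (M @^-1` [set k] `&` \bigcap_(i < n) (eta i.+1 @^-1` B i)) =
    (P' (M @^-1` [set k]) * \prod_(i < n) F (B i))%E.
  (* the sum starts at [eta 1], so nothing is required of [eta 0] *)
  move=> mB; pose B' i := if i is i'.+1 then B i' else setT.
  have mB' i : measurable (B' i) by case: i => [|i]; [exact: measurableT|exact: mB].
  have := M_independent n.+1 B' [set k] mB' I.
  rewrite eta_indep// big_ord_recl/= preimage_setT probability_setT mul1e.
  rewrite !bigcap_mkord big_ord_recl/= preimage_setT setTI => ->.
  by congr (_ * _)%E; apply: eq_bigr => i _; rewrite eta_id.
move=> A mA.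
have nuE B : measurable B -> law P' (measurable_random_sum HM (fun i => meta i.+1) mM) B =
    (\sum_(k <oo) (poisson_pmf th k)%:E * conv_power HM F k B)%E.
  move=> mB; rewrite (random_sum_law HM _ mM indep mB).
  by apply: eq_eseriesr => k _; rewrite M_poisson.
have := mass_equation_unique HM mu_eq (compound_poisson_mass_equation th_gt0 nuE)
  (compound_poisson_level0 th_gt0 nuE) mA.
move=> munu.
transitivity (P ((fun w => shifted_window C t 0 (Xi w)) @^-1` A)).
  by congr (P _); apply/seteqP; split => w /=; rewrite shifted_window0.
transitivity (P' ((fun w => partial_sum (@add_window R J C t) (zero_window C t)
    (fun i => eta i.+1) (M w) w) @^-1` A)); first exact: munu.
by congr (P' _); apply/seteqP; split => w /=; rewrite -sum_window_partial_sum.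
Qed.
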